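(* If $X$ is a Banach space with separable dual, then the $\ell_1^+$-weakly null index of $X$ satisfies $I^+_w(X)=\omega^\alpha$ for some $\alpha<\omega_1$.
   Context: Trees. A tree is a non-empty partially ordered set $(T,\le)$ such that $\{y\in T:y\le x\}$ is linearly ordered and finite for each $x\in T$; its elements are called nodes. The derived tree is $D(T)=\{x\in T: x<y\text{ for some }y\in T\}$; $T^0=T$, $T^{\alpha+1}=D(T^\alpha)$, $T^\alpha=\bigcap_{\beta<\alpha}T^\beta$ for limit $\alpha$. The order $o(T)$ is the least $\alpha<\omega_1$ with $T^\alpha=\emptyset$ if there is one, and $o(T)=\omega_1$ otherwise. A tree on a set $X$ is a subset of $\bigcup_{n\ge1}X^n$ ordered by $(x_1,\dots,x_m)\le(y_1,\dots,y_n)$ iff $m\le n$ and $x_i=y_i$ for $i\le m$. Tree isomorphism means order isomorphism. The trees $T(\alpha,s)$, $1\le\alpha<\omega_1$: $T(1,s)$ is a countably infinite set of pairwise incomparable nodes; $T(\alpha+1,s)$ is obtained from a countably infinite set of pairwise incomparable nodes by placing after each of them a copy of $T(\alpha,s)$; for limit $\alpha$, one fixes a sequence of successor ordinals $\alpha_n\nearrow\alpha$ and $T(\alpha,s)$ is the disjoint (mutually incomparable) union of copies of $T(\alpha_n,s)$, $n\ge1$. One has $o(T(\alpha,s))=\alpha$. A tree $T$ on a Banach space $X$ is said to be isomorphic to $T(\alpha,s)$ if it is order isomorphic to it and, in addition, $(x_1,\dots,x_k)\in T$, $k\ge 2$, implies $(x_1,\dots,x_{k-1})\in T$. If $(z^i)_{i\ge1}$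 is the sequence of all initial nodes, $z^i=(y_i)$, or the sequence of all immediate successors $z^i=(x_1,\dots,x_k,y_i)$ of a node $(x_1,\dots,x_k)$, then $(y_i)_{i\ge1}$ is called an $s$-subsequence of $T$ (each such sequence is enumerated by a fixed bijection with $\mathbf N$). A weakly null tree on $X$ is a tree on $X$ isomorphic to $T(\alpha,s)$ for some $\alpha<\omega_1$ all of whose $s$-subsequences are weakly null. $\ell_1^+$-weakly null index. For $K\ge1$, a finite sequence $(x_i)_1^m$ in $X$ is an $\ell_1^+$-$K$-sequence if it is normalized, basic with basis constant at most $K$, and $\frac1K\sum_1^m a_i\le\|\sum_1^m a_ix_i\|$ for all $a_i\ge0$. An $\ell_1^+$-$K$-weakly null tree is a weakly null tree on $X$ each of whose nodes is an $\ell_1^+$-$K$-sequence. $I^+_w(X)=\sup_{K\ge1}\sup\{o(T): T \text{ is an } \ell_1^+\text{-}K\text{-weakly null tree on }X\}$.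
   Formalization: The Banach space X is assumed infinite dimensional: in a finite-dimensional space there are no ℓ1+-K-weakly null trees, so the index would be sup ∅ = 0, which is not of the form ω^α. *)

(* Defs.v *)
From HB Require Import structures.
From mathcomp Require Import all_boot all_order all_algebra.
From mathcomp Require Import all_classical all_reals all_analysis.
Set Implicit Arguments.
Unset Strict Implicit.
Unset Printing Implicit Defensive.
Import Order.TTheory GRing.Theory Num.Theory.
Import numFieldNormedType.Exports.
Local Open Scope classical_set_scope.
Local Open Scope ring_scope.

(** ** Countable ordinals *)

(* Codes for the ordinals < omega_1: [CLim f] denotes sup_n (f n), for an
   arbitrary sequence f, so that every countable ordinal has a code (in fact
   many), and [CLim f] need not denote a limit ordinal. Codes are compared with
   [cle], [clt] and [ceq], never with Leibniz equality. *)
Inductive cord : Type :=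
| CZero : cord
| CSucc : cord -> cord
| CLim : (nat -> cord) -> cord.

Inductive cle : cord -> cord -> Prop :=
| cle_zero b : cle CZero b
| cle_succ a b : cle a b -> cle (CSucc a) (CSucc b)
| cle_lim a f n : cle a (f n) -> cle a (CLim f)
| lim_cle f b : (forall n, cle (f n) b) -> cle (CLim f) b.

Definition clt (a b : cord) : Prop := cle (CSucc a) b.
Definition ceq (a b : cord) : Prop := cle a b /\ cle b a.

Definition cone : cord := CSucc CZero.
Definition comega : cord := CLim (fun n => iter n CSucc CZero).

Definition is_limit (a : cord) : Prop :=
  clt CZero a /\ forall b, clt b a -> clt (CSucc b) a.

Fixpoint cadd (a b : cord) : cord :=
  match b with
  | CZero => a
  | CSucc b' => CSucc (cadd a b')
  | CLim f => CLim (fun n => cadd a (f n))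
  end.

Fixpoint cmul (a b : cord) : cord :=
  match b with
  | CZero => CZero
  | CSucc b' => cadd (cmul a b') a
  | CLim f => CLim (fun n => cmul a (f n))
  end.

(* omega ^ a *)
Fixpoint omega_pow (a : cord) : cord :=
  match a with
  | CZero => cone
  | CSucc b => cmul (omega_pow b) comega
  | CLim f => CLim (fun n => omega_pow (f n))
  end.

(* The ordinals <= omega_1. *)
Inductive xord : Type :=
| Countable_ord : cord -> xord
| Omega1 : xord.

Definition xle (u v : xord) : Prop :=
  match u, v with
  | Countable_ord a, Countable_ord b => cle a b
  | Omega1, Countable_ord _ => False
  | _, Omega1 => True
  end.

Definition is_xsup (S : set xord) (v : xord) : Prop :=
  (forall u, S u -> xle u v) /\
  (forall w, (forall u, S u -> xle u w) -> xle v w).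

(** ** Derived trees and the order of a tree *)

Section Derivation.
Context {U : Type} (le : U -> U -> Prop).

Definition derived_tree (T : set U) : set U :=
  [set x | T x /\ exists y, [/\ T y, le x y & x <> y]].

(* As T^a decreases with a, intersecting the T^(f n) is the same as
   intersecting all T^b with b < sup_n (f n) when that sup is a limit, and
   gives T^(sup_n (f n)) also when the sup is attained. *)
Fixpoint iter_derived_tree (T : set U) (a : cord) : set U :=
  match a with
  | CZero => T
  | CSucc b => derived_tree (iter_derived_tree T b)
  | CLim f => \bigcap_n iter_derived_tree T (f n)
  end.

Definition is_tree_order (T : set U) (v : xord) : Prop :=
  match v with
  | Countable_ord a => iter_derived_tree T a = set0 /\
      forall b, iter_derived_tree T b = set0 -> cle a b
  | Omega1 => forall b, iter_derived_tree T b <> set0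
  end.

End Derivation.

(** ** The trees T(a, s) *)

(* A choice, for each countable limit ordinal a (independently of its code), of
   a strictly increasing sequence of successor ordinals with supremum a. *)
Definition fundamental_system (fs : cord -> nat -> cord) : Prop :=
  (forall a, is_limit a ->
     [/\ forall n, exists b, ceq (fs a n) (CSucc b),
         forall n, clt (fs a n) (fs a n.+1)
       & ceq (CLim (fs a)) a]) /\
  (forall a b, is_limit a -> ceq a b -> forall n, ceq (fs a n) (fs b n)).

(* (n, None) is the n-th initial node, and (n, Some x) is the node x in the
   copy of A placed after it. *)
Definition graft_le (A : Type) (le : A -> A -> Prop) (u v : nat * option A) :
    Prop :=
  u.1 = v.1 /\
  match u.2, v.2 with
  | None, _ => True
  | Some x, Some y => le x y
  | Some _, None => False
  end.

Inductive union_le (A : nat -> Type) (le : forall n, A n -> A n -> Prop) :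
    {n : nat & A n} -> {n : nat & A n} -> Prop :=
| union_le_intro n (x y : A n) :
    le n x y -> union_le le (existT A n x) (existT A n y).

(* [is_Ts fs a A le]: the ordered set (A, le) is T(a, s). *)
Inductive is_Ts (fs : cord -> nat -> cord) :
    cord -> forall A : Type, (A -> A -> Prop) -> Prop :=
| Ts_one a :
    ceq a cone -> is_Ts fs a (@eq nat)
| Ts_succ a b (A : Type) (le : A -> A -> Prop) :
    is_Ts fs b le -> ceq a (CSucc b) -> is_Ts fs a (graft_le le)
| Ts_lim a (A : nat -> Type) (le : forall n, A n -> A n -> Prop) :
    is_limit a -> (forall n, is_Ts fs (fs a n) (le n)) ->
    is_Ts fs a (union_le le).

(** ** Trees on a Banach space *)

Section TreesOnSpace.
Context {R : realType} {X : completeNormedModType R}.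
Implicit Types (T : set (seq X)) (s x z : seq X).

Definition node_le s z : Prop := prefix s z.

Definition tree_on T : Prop := T !=set0 /\ ~ T [::].

Definition isomorphic_to_Ts (fs : cord -> nat -> cord) (a : cord) T : Prop :=
  (exists (A : Type) (le : A -> A -> Prop) (h : A -> seq X),
     [/\ is_Ts fs a le, set_bij setT T h
       & forall u v, le u v <-> node_le (h u) (h v)]) /\
  (forall x (y : X), x <> [::] -> T (rcons x y) -> T x).

Definition initial_nodes T : set (seq X) :=
  [set z | T z /\ forall w, T w -> node_le w z -> w = z].

Definition immediate_successors T x : set (seq X) :=
  [set z | [/\ T z, node_le x z, x <> z
    & forall w, T w -> node_le x w -> x <> w -> node_le w z -> w = z]].

Definition s_subsequence T (y : nat -> X) : Prop :=
  set_bij setT (initial_nodes T) (fun i => [:: y i]) \/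
  exists x, T x /\
    set_bij setT (immediate_successors T x) (fun i => rcons x (y i)).

Definition weakly_null (y : nat -> X) : Prop :=
  forall f : {linear X -> R^o}, continuous f -> f (y n) @[n --> \oo] --> 0.

(* Weak nullness does not depend on the enumeration of the immediate
   successors, so all enumerations are allowed in [s_subsequence]. *)
Definition weakly_null_tree (fs : cord -> nat -> cord) T : Prop :=
  [/\ tree_on T,
      exists a, cle cone a /\ isomorphic_to_Ts fs a T
    & forall y, s_subsequence T y -> weakly_null y].

Definition normalized s : Prop := forall u : X, u \in s -> `|u| = 1.

Definition basic_with_constant_le (K : R) s : Prop :=
  (forall a : nat -> R, \sum_(i < size s) a i *: s`_i = 0 ->
     forall i, (i < size s)%N -> a i = 0) /\
  (forall (a : nat -> R) (n : nat), (n <= size s)%N ->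
     `|\sum_(i < n) a i *: s`_i| <= K * `|\sum_(i < size s) a i *: s`_i|).

Definition l1plus_sequence (K : R) s : Prop :=
  [/\ normalized s, basic_with_constant_le K s
    & forall a : nat -> R, (forall i, 0 <= a i) ->
        K^-1 * \sum_(i < size s) a i <= `|\sum_(i < size s) a i *: s`_i|].

Definition l1plus_weakly_null_tree (fs : cord -> nat -> cord) (K : R) T : Prop :=
  weakly_null_tree fs T /\ forall s, T s -> l1plus_sequence K s.

End TreesOnSpace.

(* [is_l1plus_wn_index fs X v]: the l_1^+-weakly null index of X is v. *)
Definition is_l1plus_wn_index (fs : cord -> nat -> cord) (R : realType)
    (X : completeNormedModType R) (v : xord) : Prop :=
  is_xsup [set u | exists K : R, 1 <= K /\
    is_xsup [set w | exists T : set (seq X),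
      l1plus_weakly_null_tree fs K T /\ is_tree_order node_le T w] u] v.

(** ** Hypotheses on the space *)

Section Spaces.
Context {R : realType} (X : completeNormedModType R).

Definition infinite_dimensional : Prop :=
  ~ exists (n : nat) (e : 'I_n -> X),
      forall x, exists a : 'I_n -> R, x = \sum_(i < n) a i *: e i.

Definition dual : set {linear X -> R^o} := [set f | continuous f].

Definition dual_norm (f : X -> R) : R :=
  sup [set `|f x| | x in [set x : X | `|x| <= 1]].

Definition separable_dual : Prop :=
  exists D : set {linear X -> R^o},
    [/\ countable D, D `<=` dual
      & forall f, dual f -> forall e : R, 0 < e ->
          exists2 g, D g & dual_norm (fun x => f x - g x) < e].

End Spaces.

(* Main.v *)
Require Import Defs.
From HB Require Import structures.
From mathcomp Require Import all_boot all_order all_algebra.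
From mathcomp Require Import all_classical all_reals all_analysis.
From mathcomp Require Import lra.
(* charge.v also defines a [cadd]. *)
Import Defs.

(** Derive a set of finite sequences in X by keeping those that have one-term
extensions in the set in every weak neighbourhood of 0. With (f_j) norm dense
in the dual, it suffices to consider the neighbourhoods |f_j y| <= 1/(m+1),
j <= m, so weakly null sequences can be picked with uniform control and a
countable union of such choices stays weakly null. Hence an l_1^+-K-weakly
null tree of order c >= 1 exists iff the empty sequence survives c derivations
of the set of all l_1^+-K-sequences, whatever the fundamental sequences.

The ordinals attained for some K form an initial segment. It is bounded: if all
c < omega_1 were attained for one K, approximating nodes by a countable dense
subset of X would give an infinite branch, a weakly null sequence on whose
convex combinations the norm stays above 1/(2K). It is closed under addition:
if s and t are l_1^+-K and t is chosen far out, so that s ++ t is basic by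
Mazur's lemma, then s ++ t is l_1^+-5K, so a tree can be placed after every
node of another one. A bounded initial segment containing 1 and closed under
addition has supremum omega^a. *)

Set Implicit Arguments.
Unset Strict Implicit.
Unset Printing Implicit Defensive.
Import Order.TTheory GRing.Theory Num.Theory.
Import numFieldNormedType.Exports.
Local Open Scope classical_set_scope.
Local Open Scope ring_scope.

(** * Countable ordinals *)

Lemma cle_refl a : cle a a.
Proof.
elim: a => [|a IH|f IH]; first exact: cle_zero.
- exact: cle_succ.
- by apply: lim_cle => n; apply: cle_lim (IH n).
Qed.

Lemma lim_cle_inv f c n : cle (CLim f) c -> cle (f n) c.
Proof.
move E : (CLim f) => l H; elim: H E => //.
- by move=> a g m _ IH /IH; apply: cle_lim.
- by move=> g b H _ [->].
Qed.

Lemma cle_succ_inv a b : cle (CSucc a) (CSucc b) -> cle a b.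
Proof. by move=> H; inversion H. Qed.

Lemma clt_lim_inv a f : clt a (CLim f) -> exists n, clt a (f n).
Proof. by move=> H; inversion H; exists n. Qed.

Lemma not_clt_zero a : ~ clt a CZero.
Proof. by move=> H; inversion H. Qed.

Lemma cle_trans b a c : cle a b -> cle b c -> cle a c.
Proof.
move=> H; elim: H c => {a b}.
- by move=> *; apply: cle_zero.
- move=> a b _ IH c; move E : (CSucc b) => l H; elim: H E => //.
  + by move=> b' d bd _ [E]; subst b'; apply/cle_succ/IH.
  + by move=> d f n _ IHd /IHd; apply: cle_lim.
- by move=> a f n _ IH c /(@lim_cle_inv _ _ n); apply: IH.
- by move=> f b _ IH c bc; apply: lim_cle => n; apply: IH.
Qed.

Lemma cle_CSucc a : cle a (CSucc a).
Proof.
elim: a => [|a IH|f IH]; first exact: cle_zero.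
- exact: cle_succ.
- apply: lim_cle => n; apply: cle_trans (IH n) _; apply: cle_succ.
  exact: cle_lim (cle_refl _).
Qed.

Lemma cltW a b : clt a b -> cle a b.
Proof. exact: cle_trans (cle_CSucc a). Qed.

Lemma cle_lub f n : cle (f n) (CLim f).
Proof. exact: cle_lim (cle_refl _). Qed.

Lemma cle_or_clt a b : cle a b \/ clt b a.
Proof.
elim: a b => [|a IHa|f IHf] b; first by left; apply: cle_zero.
- elim: b => [|b IHb|g IHg].
  + by right; apply/cle_succ/cle_zero.
  + by have [ab|ba] := IHa b; [left|right]; apply: cle_succ.
  + have [[n an]|H] := pselect (exists n, cle (CSucc a) (g n)).
      by left; apply: cle_lim an.
    right; apply/cle_succ/lim_cle => n; have [an|] := IHg n.
      by case: H; exists n.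
    exact: cle_succ_inv.
- have [H|/existsNP[n Hn]] := pselect (forall n, cle (f n) b).
    by left; apply: lim_cle.
  by right; have [//|] := IHf n b; apply: cle_lim.
Qed.

Lemma clt_irrefl a : ~ clt a a.
Proof.
elim: a => [|a IH|f IH]; first exact: not_clt_zero.
- by move/cle_succ_inv.
- move/clt_lim_inv => [n H]; apply: (IH n); apply: cle_trans H.
  exact/cle_succ/cle_lub.
Qed.

Lemma cle_not_clt a b : cle a b <-> ~ clt b a.
Proof.
split=> [ab ba|]; last by have [] := cle_or_clt a b.
exact: clt_irrefl (cle_trans ba ab).
Qed.

(** The induction proves that everything below the code [a] is accessible: an element strictly below
    [CLim f] already lies below some [f n]. *)
Lemma clt_wf : well_founded clt.
Proof.
move=> a; elim: a {-2}a (cle_refl a) => [|a IH|f IH] b ba; constructor=> c cb.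
- by case: (not_clt_zero (cle_trans cb ba)).
- by apply: IH; apply: cle_succ_inv (cle_trans cb ba).
- by have [n /cltW cn] := clt_lim_inv (cle_trans cb ba); apply: IH cn.
Qed.

(** A [CLim] code can denote zero or a successor, so the cases are told apart by value: a nonzero
    [a] is a successor as soon as some b < a fails to satisfy b + 1 < a. *)
Lemma cord_cases a :
  [\/ cle a CZero, exists b, ceq a (CSucc b) | is_limit a].
Proof.
have [?|a0] := cle_or_clt a CZero; first by constructor 1.
have [[b [ba nba]]|H] := pselect (exists b, clt b a /\ ~ clt (CSucc b) a).
  by constructor 2; exists b; split=> //; apply/cle_not_clt.
constructor 3; split=> // b ba; apply: contrapT => nb.
by apply: H; exists b.
Qed.

Lemma cadd_mono a b c : cle b c -> cle (cadd a b) (cadd a c).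
Proof.
elim=> {b c} [b|b c _ IH|b f n _ IH|f b _ IH] /=.
- elim: b => [|b IH|f IH] /=; first exact: cle_refl.
  + exact: cle_trans IH (cle_CSucc _).
  + exact: cle_trans (IH 0) (@cle_lub (fun n => cadd a (f n)) 0).
- exact: cle_succ.
- exact: cle_lim IH.
- exact: lim_cle.
Qed.

Lemma cle_caddl a b : cle b (cadd a b).
Proof.
elim: b => [|b IH|f IH] /=; first exact: cle_zero.
- exact: cle_succ.
- by apply: lim_cle => n; apply: cle_lim (IH n).
Qed.

Lemma omega_pow_gt0 a : cle cone (omega_pow a).
Proof.
elim: a => [|a IH|f IH] /=; first exact: cle_refl.
- by apply: (@cle_lim _ _ 1); apply: cle_trans IH (cle_caddl _ _).
- exact: cle_lim (IH 0).
Qed.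

(** Turns any countable bound into a bound by a power of omega, where [additively_closed_lub] starts
    its descent. *)
Lemma cle_omega_pow a : cle a (omega_pow a).
Proof.
elim: a => [|a IH|f IH] /=; first exact: cle_zero.
(* omega^a * 2 suffices: its second summand is at least 1, which provides the successor. *)
- apply: (@cle_lim _ _ 2) => /=.
  apply: cle_trans (cadd_mono _ (omega_pow_gt0 a)).
  by apply: cle_succ => /=; apply: cle_trans IH (cle_caddl _ _).
- by apply: lim_cle => n; apply: cle_lim (IH n).
Qed.

(** Induction on the code of the bound: either a predecessor in the code is a bound too, or elements
    of [S] exceed each predecessor and the bound is least. *)
Lemma bounded_cord_has_lub (S : cord -> Prop) b :
    (forall x, S x -> cle x b) ->
  exists v, (forall x, S x -> cle x v) /\
    forall w, (forall x, S x -> cle x w) -> cle v w.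
Proof.
elim: b => [|b IH|f IH] Sb.
- by exists CZero; split=> // w _; apply: cle_zero.
- have [/IH//|/existsNP[x /not_implyP[Sx xb]]] :=
    pselect (forall x, S x -> cle x b).
  exists (CSucc b); split=> // w Sw; apply: cle_trans (Sw _ Sx).
  by have [] := cle_or_clt x b.
- have [[n /IH//]|H] := pselect (exists n, forall x, S x -> cle x (f n)).
  exists (CLim f); split=> // w Sw; apply: lim_cle => n.
  have /existsNP[x /not_implyP[Sx xf]] : ~ (forall x, S x -> cle x (f n)).
    by move=> Hn; apply: H; exists n.
  apply: cle_trans (Sw _ Sx).
  by have [|/cltW] := cle_or_clt x (f n).
Qed.

(* Descends along the code of [a]: as long as [omega_pow a] is not the least
   upper bound, some predecessor of [a] in the code still gives a bound. *)
Lemma additively_closed_lub (S : cord -> Prop) a :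
    S cone -> (forall x y, cle x y -> S y -> S x) ->
    (forall x y, S x -> S y -> S (cadd x y)) ->
    (forall x, S x -> cle x (omega_pow a)) ->
  exists c, (forall x, S x -> cle x (omega_pow c)) /\
    forall w, (forall x, S x -> cle x w) -> cle (omega_pow c) w.
Proof.
move=> S1 Sdown Sadd.
have unbounded c : ~ (forall x, S x -> cle x c) -> S c.
  move=> /existsNP[x /not_implyP[Sx xc]]; apply: Sdown Sx.
  by have [|/cltW] := cle_or_clt x c.
elim: a => [|a IH|f IH] Sa.
- by exists CZero; split=> // w; apply.
- have [/IH//|/unbounded Soa] := pselect (forall x, S x -> cle x (omega_pow a)).
  exists (CSucc a); split=> // w Sw; apply: lim_cle => n; apply: Sw.
  elim: n => [|n IHn] /=; first exact: Sdown (cle_zero _) S1.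
  exact: Sadd.
- have [[n /IH//]|H] :=
    pselect (exists n, forall x, S x -> cle x (omega_pow (f n))).
  exists (CLim f); split=> // w Sw; apply: lim_cle => n; apply/Sw/unbounded.
  by move=> Hn; apply: H; exists n.
Qed.

(** * The trees T(a, s) and their order *)

Lemma iter_derived_tree_image {A U : Type} (leA : A -> A -> Prop)
    (leU : U -> U -> Prop) (h : A -> U) a :
    injective h -> (forall u v, leA u v <-> leU (h u) (h v)) ->
  iter_derived_tree leU (range h) a = h @` iter_derived_tree leA setT a.
Proof.
move=> hI hle; elim: a => [|a IH|f IH] //=.
- rewrite IH; apply/seteqP; split=> x.
  + move=> [[u ua <-] [_ [[v va <-] /hle uv nuv]]]; exists u => //; split=> //.
    by exists v; split=> // E; apply: nuv; rewrite E.
  + move=> [u [ua [v [va /hle uv nuv]]] <-]; split; first by exists u.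
    by exists (h v); split=> // /hI.
- apply/seteqP; split=> x.
  (* Index 0 supplies the preimage, and injectivity of [h] makes it serve every n. *)
  + move=> H; have := H 0 I; rewrite IH => -[u _ ux]; exists u => // n _.
    by have := H n I; rewrite IH -ux => -[v vn /hI <-].
  + by move=> [u uf <-] n _; rewrite IH; exists u => //; apply: uf.
Qed.

Lemma existT_nat_inj (A : nat -> Type) n (x y : A n) :
  existT A n x = existT A n y -> x = y.
Proof. by apply: Eqdep_dec.inj_pair2_eq_dec; exact: PeanoNat.Nat.eq_dec. Qed.

Lemma union_le_inv (A : nat -> Type) (le : forall n, A n -> A n -> Prop) n x w :
  union_le le (existT A n x) w -> exists2 y, w = existT A n y & le n x y.
Proof.
move E : (existT A n x) => z H; case: H E => m x' y' xy E.
have nm : n = m by case: E.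
by subst m; rewrite (existT_nat_inj E); exists y'.
Qed.

Section Ts.
Variable fs : cord -> nat -> cord.
Hypothesis hfs : fundamental_system fs.

Lemma fs_lt a n : is_limit a -> clt (fs a n) a.
Proof.
move=> la; have [_ inc [sup_le _]] := hfs.1 a la.
exact: cle_trans (inc n) (cle_trans (@cle_lub (fs a) _) sup_le).
Qed.

Lemma clt_fs a b : is_limit a -> clt b a -> exists n, clt b (fs a n).
Proof.
move=> la ba; have [_ _ [_ le_sup]] := hfs.1 a la.
exact: clt_lim_inv (cle_trans ba le_sup).
Qed.

Lemma fs_gt0 a n : is_limit a -> cle cone (fs a n).
Proof.
move=> la; have [/(_ n)[b [_ ba]] _ _] := hfs.1 a la.
exact: cle_trans (cle_succ (cle_zero b)) ba.
Qed.

(** Grafted copies and components of a union are derived independently of the rest, so only the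
    initial nodes of a graft need a separate count. *)
Lemma is_Ts_order a (A : Type) (le : A -> A -> Prop) : is_Ts fs a le ->
  forall c, iter_derived_tree le setT c !=set0 <-> clt c a.
Proof.
elim=> {a A le} [a [a1 a2]|a b A le _ IH [ab ba]|a A le la _ IH] c.
- have H u : iter_derived_tree (@eq nat) setT c u <-> cle c CZero.
    elim: c u => [|c IHc|f IHf] u /=.
    + by split=> // _; apply: cle_zero.
    + by split=> [[_ [y []]]|/not_clt_zero].
    + split=> [H|H n _]; first by apply: lim_cle => n; apply/(IHf n u)/H.
      by apply/IHf; apply: lim_cle_inv H.
  split=> [[u /H c0]|ca]; first exact: cle_trans (cle_succ c0) a2.
  by exists 0; apply/H/cle_succ_inv/(cle_trans ca).
- have HS d n u :
      iter_derived_tree (graft_le le) setT d (n, Some u) <->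
      iter_derived_tree le setT d u.
    elim: d u => [|d IHd|f IHf] u //=.
    + split=> [[/IHd du [[m [v|]] [/= vd [/= nm uv] nuv]]]|
                [du [v [dv uv nuv]]]].
      * split=> //; exists v; split=> //; last by move=> E; rewrite nm E in nuv.
        by apply/IHd; rewrite nm.
      * by [].
      * split; first exact/IHd.
        by exists (n, Some v); split=> [|//|[]//]; apply/IHd.
    + by split=> H k _; apply/IHf/H.
  (* The n-th initial node passes from stage d to d + 1 iff its copy of [A] still has a node at
     stage d, that is iff d < b. *)
  have HN d n : iter_derived_tree (graft_le le) setT d (n, None) <-> cle d b.
    elim: d => [|d IHd|f IHf] /=.
    + by split=> // _; apply: cle_zero.
    + split=> [[_ [[m [v|]] [/= vd [/= nm _] nuv]]]|db].
      * by apply/IH; exists v; rewrite -HS; exact: vd.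
      * by rewrite nm in nuv.
      * split; first exact/IHd/cltW.
        by have /IH[v vd] := db; exists (n, Some v); split=> //; apply/HS.
    + split=> [H|H k _]; first by apply: lim_cle => k; apply/IHf/H.
      by apply/IHf; apply: lim_cle_inv H.
  split=> [[[n [u|]]]|ca].
  + move=> /HS ud; apply: cle_trans ba; apply: cle_trans (cle_CSucc b).
    by apply/IH; exists u.
  + by move=> /HN cb; apply: cle_trans ba; apply: cle_succ.
  + by exists (0, None); apply/HN/cle_succ_inv/(cle_trans ca).
- have HU d n u : iter_derived_tree (union_le le) setT d (existT A n u) <->
      iter_derived_tree (le n) setT d u.
    elim: d u => [|d IHd|f IHf] u //=.
    + split=> [[/IHd du [v [vd uv nuv]]]|[du [v [dv uv nuv]]]].
      * have [y ? uy] := union_le_inv uv; subst v.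
        split=> //; exists y; split=> //; first exact/IHd.
        by move=> F; apply: nuv; rewrite F.
      * split; first exact/IHd.
        exists (existT A n v); split=> //; first exact/IHd.
        by move=> E; apply: nuv; apply: existT_nat_inj E.
    + by split=> H k _; apply/IHf/H.
  split=> [[[n u] /HU un]|ca].
  + have H : clt c (fs a n) by apply/IH; exists u.
    exact: cle_trans H (cltW (fs_lt n la)).
  + have [n /IH[u un]] := clt_fs la ca.
    by exists (existT A n u); apply/HU.
Qed.

End Ts.

(** * The Hahn-Banach theorem *)

Section HahnBanach.
Context {R : realType} {X : lmodType R}.

Definition sublinear (q : X -> R) :=
  (forall x y, q (x + y) <= q x + q y) /\
  (forall (t : R) x, 0 <= t -> q (t *: x) = t * q x).

Definition convex_cone (C : X -> R -> Prop) :=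
  [/\ C 0 0, forall y c z d, C y c -> C z d -> C (y + z) (c + d)
    & forall (t : R) y c, 0 <= t -> C y c -> C (t *: y) (t * c)].

Lemma sublinear0 q : sublinear q -> q 0 = 0.
Proof. by move=> [_ qZ]; rewrite -(scale0r 0) qZ// mul0r. Qed.

Lemma sublinear_opp q x : sublinear q -> - q (- x) <= q x.
Proof.
move=> qS; have := qS.1 x (- x); rewrite subrr sublinear0//; lra.
Qed.

(** Lowers [q] so as to encode the constraints of [C]: a linear f below it satisfies f (- y) <= - c
    by [cone_inf_opp], hence c <= f y on [C]. *)
Definition cone_inf (q : X -> R) (C : X -> R -> Prop) (x : X) : R :=
  inf [set r | exists y c, C y c /\ r = q (x + y) - c].

Section ConeInf.
Variables (q : X -> R) (C : X -> R -> Prop).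
Hypothesis qS : sublinear q.
Hypothesis CC : convex_cone C.
Hypothesis Cq : forall y c, C y c -> c <= q y.

Lemma cone_inf_le x y c : C y c -> cone_inf q C x <= q (x + y) - c.
Proof.
move=> Cy; apply: ge_inf; last by exists y, c.
exists (- q (- x)) => _ [z [d [Cz ->]]].
have := qS.1 (x + z) (- x); rewrite addrAC subrr add0r.
have := Cq Cz; lra.
Qed.

Lemma cone_inf_ge x r : (forall y c, C y c -> r <= q (x + y) - c) ->
  r <= cone_inf q C x.
Proof.
move=> H; apply: lb_le_inf; last by move=> _ [y [c [Cy ->]]]; apply: (H).
by have [C0 _ _] := CC; exists (q (x + 0) - 0), 0, 0.
Qed.

Lemma cone_inf_sublinear : sublinear (cone_inf q C).
Proof.
have [C0 CD CZ] := CC; split=> [x z|t x].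
- suff: cone_inf q C (x + z) - cone_inf q C z <= cone_inf q C x by lra.
  apply: cone_inf_ge => y c Cy.
  suff: cone_inf q C (x + z) - (q (x + y) - c) <= cone_inf q C z by lra.
  apply: cone_inf_ge => w d Cw.
  have := cone_inf_le (x + z) (CD _ _ _ _ Cy Cw).
  have := qS.1 (x + y) (z + w); rewrite addrACA; lra.
(* One inequality for all positive scalars is enough; the reverse one comes from the inverse
   scalar. *)
- have H s z : 0 < s -> s * cone_inf q C z <= cone_inf q C (s *: z).
    move=> s0; apply: cone_inf_ge => y c Cy.
    have := cone_inf_le z (CZ s^-1 _ _ _ Cy).
    rewrite invr_ge0 ltW// => /(_ isT) le1.
    have -> : s *: z + y = s *: (z + s^-1 *: y).
      by rewrite scalerDr scalerA mulfV ?scale1r// gt_eqF.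
    rewrite (qS.2 _ _ (ltW s0)).
    rewrite -(ler_pM2l s0) mulrBr mulrA mulfV ?mul1r ?gt_eqF// in le1.
  rewrite le_eqVlt => /predU1P[<-|t0].
    rewrite scale0r mul0r; apply/le_anti/andP; split.
      by apply: le_trans (cone_inf_le 0 C0) _; rewrite addr0 sublinear0// subr0.
    by apply: cone_inf_ge => y c Cy; rewrite add0r; have := Cq Cy; lra.
  apply/le_anti/andP; split; last exact: H.
  have := H t^-1 (t *: x); rewrite invr_gt0 => /(_ t0).
  by rewrite scalerA mulVf ?scale1r ?gt_eqF// ler_pdivrMl.
Qed.

Lemma cone_inf_le_id x : cone_inf q C x <= q x.
Proof.
by have [C0 _ _] := CC; apply: le_trans (cone_inf_le x C0) _;
  rewrite addr0 subr0.
Qed.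

Lemma cone_inf_opp y c : C y c -> cone_inf q C (- y) <= - c.
Proof.
by move=> Cy; apply: le_trans (cone_inf_le _ Cy) _;
  rewrite addNr sublinear0// add0r.
Qed.

End ConeInf.

(** Zorn's lemma for the reversed pointwise order. A chain is bounded by its pointwise infimum,
    which is finite because a sublinear q <= p satisfies - p (- x) <= q x. *)
Lemma minimal_sublinear p : sublinear p ->
  exists q, [/\ sublinear q, forall x, q x <= p x
    & forall q', sublinear q' -> (forall x, q' x <= q x) -> q' = q].
Proof.
move=> pS; pose T := {q : X -> R | sublinear q /\ forall x, q x <= p x}.
pose le (q1 q2 : T) := `[< forall x, sval q2 x <= sval q1 x >].
have sval_T_inj : injective (fun q : T => sval q).
  by move=> [q Hq] [q' Hq'] /= E; subst q'; congr exist;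
    apply: Prop_irrelevance.
have [||||[q [qS qp]] qmin] := @Zorn T le.
- by move=> q; apply/asboolP => x.
- move=> q r s /asboolP qr /asboolP rs; apply/asboolP => x.
  exact: le_trans (rs x) (qr x).
- move=> q r /asboolP qr /asboolP rq; apply: sval_T_inj; apply/funext => x.
  by apply/le_anti/andP; split; [apply: rq | apply: qr].
- move=> A Atot; have [[q0 Aq0]|noA] := pselect (exists q, A q); last first.
    by exists (exist _ p (conj pS (fun x => lexx _))) => s As; case: noA;
      exists s.
  pose m x := inf [set sval q x | q in A].
  have m_le q x : A q -> m x <= sval q x.
    move=> Aq; apply: ge_inf; last by exists q.
    exists (- p (- x)) => _ [r Ar <-].
    have [rS rp] := svalP r; apply: le_trans (sublinear_opp x rS).
    by rewrite lerN2.
  have m_ge x r : (forall q, A q -> r <= sval q x) -> r <= m x.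
    move=> H; apply: lb_le_inf; first by exists (sval q0 x), q0.
    by move=> _ [q Aq <-]; apply: (H).
  have mS : sublinear m.
    split=> [x y|t x].
    + suff: m (x + y) - m y <= m x by lra.
      apply: (m_ge) => q Aq; suff: m (x + y) - sval q x <= m y by lra.
      apply: (m_ge) => r Ar.
      (* In a chain, the functionals nearly attaining the infimum at x and at y can be replaced by
         the smaller of the two. *)
      have [s [As sq sr]] : exists s, [/\ A s,
          sval s x <= sval q x & sval s y <= sval r y].
        by have [/asboolP H|/asboolP H] := Atot _ _ Aq Ar; [exists r|exists q].
      have := m_le _ (x + y) As; have := (svalP s).1.1 x y; lra.
    + rewrite le_eqVlt => /predU1P[<-|t0].
        rewrite scale0r mul0r; apply/le_anti/andP; split.
          by apply: le_trans (m_le _ _ Aq0) _;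
            rewrite (sublinear0 (svalP q0).1).
        by apply: (m_ge) => q Aq; rewrite (sublinear0 (svalP q).1).
      apply/le_anti/andP; split.
        rewrite -ler_pdivrMl//; apply: (m_ge) => q Aq.
        rewrite ler_pdivrMl// -((svalP q).1.2 _ _ (ltW t0)); exact: (m_le).
      by apply: (m_ge) => q Aq;
        rewrite ((svalP q).1.2 _ _ (ltW t0)) ler_pM2l//; apply: (m_le).
  have mp x : m x <= p x by apply: le_trans (m_le _ _ Aq0) ((svalP q0).2 x).
  by exists (exist _ m (conj mS mp)) => q Aq; apply/asboolP => x /=;
    apply: (m_le).
- exists q; split=> // q' q'S q'q.
  have q'p x : q' x <= p x by apply: le_trans (q'q x) (qp x).
  by have /= := qmin (exist _ q' (conj q'S q'p));
    rewrite /le => /(_ (asboolT q'q))/(congr1 sval).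
Qed.

(* Lower [p] to [cone_inf p C], which forces [c <= f y] on [C], then to a
   minimal sublinear functional [f]. Minimality makes [f] additive: lowering
   [f] along the ray through [(y, f y)] must give [f] back. *)
Theorem hahn_banach_cone p C : sublinear p -> convex_cone C ->
    (forall y c, C y c -> c <= p y) ->
  exists f : {linear X -> R^o},
    (forall x, f x <= p x) /\ forall y c, C y c -> c <= f y.
Proof.
move=> pS CC Cp.
have [g [gS gp gmin]] := minimal_sublinear (cone_inf_sublinear pS CC Cp).
have gD x y : g (x + y) = g x + g y.
  apply/le_anti/andP; split; first exact: gS.1.
  pose D z d := exists2 t, 0 <= t & z = t *: y /\ d = t * g y.
  have DC : convex_cone D.
    split=> [|z c w d [t t0 [-> ->]] [s s0 [-> ->]]|s z c s0 [t t0 [-> ->]]].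
    - by exists 0 => //; rewrite scale0r mul0r.
    - by exists (t + s); [exact: addr_ge0 | rewrite scalerDl mulrDl].
    - by exists (s * t); [exact: mulr_ge0 | rewrite scalerA mulrA].
  have Dg z d : D z d -> d <= g z.
    by move=> [t t0 [-> ->]]; rewrite gS.2.
  have E := gmin _ (cone_inf_sublinear gS DC Dg) (cone_inf_le_id gS DC Dg).
  have := cone_inf_le gS Dg x (_ : D y (g y)); rewrite E.
  suff Dy : D y (g y) by move=> /(_ Dy); lra.
  by exists 1 => //; rewrite scale1r mul1r.
have gN x : g (- x) = - g x.
  by have := gD x (- x); rewrite subrr (sublinear0 gS); lra.
have glin : linear (g : X -> R^o).
  move=> t x y; rewrite gD; congr (_ + _).
  have [t0|t0] := leP 0 t; first exact: gS.2.
  have := gN (- t *: x);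
    rewrite gS.2 ?oppr_ge0 ?(ltW t0)// -scaleNr opprK => ->.
  by rewrite mulNr opprK.
pose glinM := GRing.isLinear.Build R X R^o _ (g : X -> R^o) glin.
pose f : {linear X -> R^o} := HB.pack (g : X -> R^o) glinM.
exists f; split=> [x|y c Cy].
- exact: le_trans (gp x) (cone_inf_le_id pS CC Cp x).
- rewrite -lerN2 -(gN y : f (- y) = _).
  exact: le_trans (gp _) (cone_inf_opp pS Cp Cy).
Qed.

End HahnBanach.

(** * Functionals on a space with separable dual *)

Lemma inv_natS_lt (R : realType) (e : R) : 0 < e ->
  exists n, forall m, (n <= m)%N -> m.+1%:R^-1 < e.
Proof.
by move=> e0; have [n _ H] := near_infty_natSinv_lt (PosNum e0); exists n.
Qed.

(** The filler [x0] lets a total sequence enumerate an empty or finite [D] as well. *)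
Lemma countable_range (T : Type) (D : set T) (x0 : T) : countable D ->
  exists F : nat -> T, (forall n, D (F n) \/ F n = x0) /\
    forall x, D x -> exists n, F n = x.
Proof.
move=> /countable_injP[f finj].
have [F FP] : {F : nat -> T & forall n, (D (F n) /\ f (F n) = n) \/
    ((forall y, D y -> f y <> n) /\ F n = x0)}.
  apply: (@choice _ _ (fun n x => (D x /\ f x = n) \/
    ((forall y, D y -> f y <> n) /\ x = x0))) => n.
  have [[y [Dy fy]]|H] := pselect (exists y, D y /\ f y = n).
    by exists y; left.
  by exists x0; right; split=> // y Dy fy; apply: H; exists y.
exists F; split=> [n|x Dx]; first by have [[? _]|[_ ?]] := FP n; [left|right].
exists (f x); have [[Dn fn]|[/(_ x Dx)//]] := FP (f x).
by apply: finj; rewrite ?inE.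
Qed.

Section Functionals.
Context {R : realType} {X : completeNormedModType R}.

Lemma functionalZ (f : {linear X -> R^o}) (t : R) x : f (t *: x) = t * f x.
Proof. by rewrite linearZ. Qed.

Lemma norm_sublinear : sublinear (fun x : X => `|x|).
Proof.
by split=> [x y|t x t0]; [exact: ler_normD | rewrite normrZ ger0_norm].
Qed.

Lemma linear_norm_le (f : {linear X -> R^o}) :
  (forall x, f x <= `|x|) -> forall x, `|f x| <= `|x|.
Proof.
move=> H x; rewrite ler_norml H andbT lerNl -linearN -normrN; exact: H.
Qed.

Lemma linear_le_continuous (f : {linear X -> R^o}) (M : R) :
  (forall x, `|f x| <= M * `|x|) -> continuous f.
Proof.
move=> H; apply/linear_bounded_continuous/linear_boundedP.
exists M; split=> [|r Mr x]; first exact: num_real.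
by apply: le_trans (H x) _; apply: ler_wpM2r => //; apply: ltW.
Qed.

Lemma continuous_linear_le (f : {linear X -> R^o}) : continuous f ->
  exists2 M : R, 0 < M & forall x, `|f x| <= M * `|x|.
Proof.
move=> /linear_bounded_continuous/linear_boundedP[M [_ H]].
exists (Num.max M 0 + 1) => [|x]; first by rewrite ltr_wpDl// le_max lexx orbT.
by apply: H; rewrite ltr_pwDr// le_max lexx.
Qed.

(* [dual_norm h] dominates |h| on the unit ball only because that ball has
   bounded image: [sup] of an unbounded set is a junk value. *)
Lemma dual_norm_ge (h : X -> R) (M : R) :
    (forall (t : R) x, h (t *: x) = t * h x) ->
      (forall x, `|h x| <= M * `|x|) ->
  forall x, `|h x| <= dual_norm h * `|x|.
Proof.
move=> hZ hM x; have [->|x0] := eqVneq x 0.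
  by rewrite -(scale0r 0) hZ mul0r !normr0 scale0r normr0 mulr0.
have nx0 : 0 < `|x| by rewrite normr_gt0.
rewrite -ler_pdivrMr//.
have -> : `|h x| / `|x| = `|h (`|x|^-1 *: x)|.
  by rewrite hZ normrM mulrC gtr0_norm ?invr_gt0.
apply: ub_le_sup; last first.
  exists (`|x|^-1 *: x) => //=.
  by rewrite normrZ gtr0_norm ?invr_gt0// mulVf ?gt_eqF.
exists `|M| => _ [y /= y1 <-]; apply: le_trans (hM y) _.
apply: le_trans (ler_norm _) _; rewrite normrM normr_id.
by rewrite ler_piMr.
Qed.

(** The cone form of Hahn-Banach is applied to the ray through (x, |x|). *)
Lemma norming_functional (x : X) : exists f : {linear X -> R^o},
  (forall y, `|f y| <= `|y|) /\ f x = `|x|.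
Proof.
pose C y c := exists2 t : R, 0 <= t & y = t *: x /\ c = t * `|x|.
have CC : convex_cone C.
  split=> [|z c w d [t t0 [-> ->]] [s s0 [-> ->]]|s z c s0 [t t0 [-> ->]]].
  - by exists 0 => //; rewrite scale0r mul0r.
  - by exists (t + s); [exact: addr_ge0 | rewrite scalerDl mulrDl].
  - by exists (s * t); [exact: mulr_ge0 | rewrite scalerA mulrA].
have [f [fn fC]] : exists f : {linear X -> R^o},
    (forall x, f x <= `|x|) /\ forall y c, C y c -> c <= f y.
  apply: hahn_banach_cone norm_sublinear CC _ => y c [t t0 [-> ->]].
  by rewrite normrZ ger0_norm.
exists f; split; first exact: linear_norm_le.
apply/le_anti; rewrite fn fC//.
by exists 1 => //; rewrite scale1r mul1r.
Qed.

End Functionals.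

(** * A dense sequence of functionals and separability of the space *)

Section SeparableDual.
Context {R : realType} {X : completeNormedModType R}.

Definition dual_dense (F : nat -> {linear X -> R^o}) :=
  (forall j, continuous (F j)) /\
  forall (f : {linear X -> R^o}) (e : R), continuous f -> 0 < e ->
    exists j, forall x, `|f x - F j x| <= e * `|x|.

Lemma separable_dual_dense : separable_dual X -> exists F, dual_dense F.
Proof.
move=> [D [Dc Ddual Ddense]].
have [F [FD DF]] := countable_range (\0 : {linear X -> R^o}) Dc.
exists F; split=> [j|f e fc e0].
  have [/Ddual//|->] := FD j.
  by apply: (@linear_le_continuous _ _ _ 0) => x /=; rewrite normr0 mul0r.
have [g Dg fg] := Ddense _ fc _ e0; have [j Fj] := DF _ Dg.
exists j => x; rewrite Fj.
have [M M0 HM] := continuous_linear_le fc.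
have [N N0 HN] := continuous_linear_le (Ddual _ Dg).
apply: le_trans (ler_wpM2r (normr_ge0 x) (ltW fg)).
apply: (@dual_norm_ge _ _ (fun x => f x - g x) (M + N)) => [t y|y].
  by rewrite (functionalZ f) (functionalZ g) mulrBr.
by rewrite mulrDl; apply: le_trans (ler_normB _ _) (lerD (HM y) (HN y)).
Qed.

Variable F : nat -> {linear X -> R^o}.
Hypothesis FD : dual_dense F.

Lemma approx_norming (x : X) (e : R) : 0 < e -> exists j,
  (forall y, `|F j y| <= (1 + e) * `|y|) /\ (1 - e) * `|x| <= F j x.
Proof.
move=> e0; have [f [fn fx]] := norming_functional x.
have [|j Fj] := FD.2 f e _ e0.
  by apply: (@linear_le_continuous _ _ _ 1) => y; rewrite mul1r.
exists j; split=> [y|].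
- have := ler_normB (f y) (f y - F j y); rewrite opprB addrC subrK.
  by have := Fj y; have := fn y; lra.
- by have := Fj x; rewrite ler_norml fx => /andP[_]; lra.
Qed.

Lemma approx_rat (x : nat -> X) (a : nat -> R) n (e : R) :
    (forall i, `|x i| <= 1) -> 0 < e ->
  exists s : seq rat,
    `|\sum_(i < n) a i *: x i - \sum_(i < size s) ratr s`_i *: x i| < e.
Proof.
move=> x1 e0; pose d := e / n.+1%:R.
have d0 : 0 < d by rewrite divr_gt0.
have [q Hq] : {q : nat -> rat & forall i, `|a i - ratr (q i)| < d}.
  apply: (@choice _ _ (fun i (q : rat) => `|a i - ratr q| < d)) => i.
  have [|q] := @rat_in_itvoo R (a i - d) (a i + d); first by lra.
  by rewrite in_itv /= => /andP[? ?]; exists q; rewrite ltr_norml; lra.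
exists (mkseq q n); rewrite size_mkseq -sumrB.
apply: le_lt_trans (_ : \sum_(i < n) d < e); last first.
  rewrite sumr_const card_ord -mulr_natl /d mulrCA gtr_pMr//.
  by rewrite ltr_pdivrMr// mul1r ltr_nat.
apply: le_trans (ler_norm_sum _ _ _) (ler_sum _ _) => i _.
rewrite nth_mkseq// -scalerBl normrZ; apply: le_trans (ltW (Hq i)).
by rewrite ler_piMr.
Qed.

(** Choose u j in the unit ball where [F j] takes at least half its norm. If x were far from the
    rational span of the u j, some f would vanish on every u j but not at x; an [F j] close to f is
    then small at u j, hence small everywhere, in particular at x. *)
Lemma separable_of_dual_dense :
  exists d : nat -> X, forall (x : X) (e : R), 0 < e ->
    exists n, `|x - d n| < e.
Proof.
have [u Hu] : {u : nat -> X & forall j, `|u j| <= 1 /\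
    forall y, `|F j y| <= 2 * `|F j (u j)| * `|y|}.
  apply: (@choice _ _ (fun j u => `|u| <= 1 /\
    forall y, `|F j y| <= 2 * `|F j u| * `|y|)) => j.
  pose N := dual_norm (F j).
  have [M M0 HM] := continuous_linear_le (FD.1 j).
  have HN y : `|F j y| <= N * `|y|.
    by apply: dual_norm_ge HM y => t z; rewrite functionalZ.
  have [N0|N0] := leP N 0.
    exists 0; split=> [|y]; first by rewrite normr0.
    rewrite linear0 normr0 mulr0 mul0r; apply: le_trans (HN y) _.
    by rewrite mulr_le0_ge0.
  have [||_ [u /= u1 <-] Nu] := @sup_adherent _
      [set `|F j x| | x in [set x : X | `|x| <= 1]] (N / 2); first by lra.
    split; first by exists `|F j 0|, 0 => //=; rewrite normr0.
    exists N => _ [y /= y1 <-]; apply: le_trans (HN y) _.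
    by rewrite ler_piMr// ltW.
  exists u; split=> // y; apply: le_trans (HN y) (ler_wpM2r (normr_ge0 _) _).
  by move: Nu; rewrite -/N -/(dual_norm (F j)) -/N; lra.
pose span (s : seq rat) : X := \sum_(i < size s) ratr s`_i *: u i.
exists (fun n => span (odflt [::] (unpickle n))) => x e e0.
suff [s Hs] : exists s, `|x - span s| < e.
  by exists (pickle s); rewrite pickleK.
apply: contrapT => Hx.
(* Half of e absorbs the replacement of real coefficients by rational ones. *)
have far n (a : nat -> R) : e / 2 <= `|x + \sum_(i < n) a i *: u i|.
  rewrite leNgt; apply/negP => lt; apply: Hx.
  have [|s Hs] := @approx_rat u (fun i => - a i) n (e / 2) (fun i => (Hu i).1).
    by lra.
  exists s; rewrite /span.
  have -> : x - \sum_(i < size s) ratr s`_i *: u i =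
      (x + \sum_(i < n) a i *: u i) +
      (\sum_(i < n) - a i *: u i - \sum_(i < size s) ratr s`_i *: u i).
    under [X in _ + (X - _)]eq_bigr do rewrite scaleNr.
    by rewrite sumrN addrA addrK.
  by apply: le_lt_trans (ler_normD _ _) _; lra.
(* The cone contains the span of the u j with c = 0, which forces f to vanish there, and (x, e/2),
   which keeps f x away from 0. *)
pose C y c := exists (t : R) n (a : nat -> R), 0 <= t /\
  y = t *: x + \sum_(i < n) a i *: u i /\ c = t * (e / 2).
have widen n m (a : nat -> R) : (n <= m)%N -> \sum_(i < n) a i *: u i =
    \sum_(i < m) (if (i < n)%N then a i else 0) *: u i.
  move=> nm; rewrite (big_ord_widen m (fun i => a i *: u i) nm) big_mkcond.
  by apply: eq_bigr => i _; case: ifP => // _; rewrite scale0r.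
have CC : convex_cone C.
  split=> [|y c z d [t [n [a [t0 [-> ->]]]]] [s [m [b [s0 [-> ->]]]]]
    |s y c s0 [t [n [a [t0 [-> ->]]]]]].
  - by exists 0, 0, (fun=> 0); rewrite big_ord0 scale0r addr0 mul0r.
  - pose cut k (c : nat -> R) i := if (i < k)%N then c i else 0.
    exists (t + s), (maxn n m), (fun i => cut n a i + cut m b i).
    split; [exact: addr_ge0|split; last by rewrite mulrDl].
    rewrite (widen n _ a (leq_maxl n m)) (widen m _ b (leq_maxr n m)).
    rewrite addrACA -scalerDl -big_split /=; congr (_ + _).
    by apply: eq_bigr => i _; rewrite scalerDl.
  - exists (s * t), n, (fun i => s * a i).
    split; [exact: mulr_ge0|split; last by rewrite mulrA].
    rewrite scalerDr scalerA scaler_sumr; congr (_ + _).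
    by apply: eq_bigr => i _; rewrite scalerA.
have [f [fn fC]] : exists f : {linear X -> R^o},
    (forall x, f x <= `|x|) /\ forall y c, C y c -> c <= f y.
  apply: hahn_banach_cone norm_sublinear CC _ => y c [t [n [a [t0 [-> ->]]]]].
  move: t0; rewrite le_eqVlt => /predU1P[<-|t0]; first by rewrite mul0r.
  have -> : t *: x + \sum_(i < n) a i *: u i =
      t *: (x + \sum_(i < n) (a i / t) *: u i).
    rewrite scalerDr scaler_sumr; congr (_ + _); apply: eq_bigr => i _.
    by rewrite scalerA mulrCA mulfV ?mulr1// gt_eqF.
  rewrite normrZ gtr0_norm// ler_pM2l//; exact: (far n (fun i => a i / t)).
have fu j : f (u j) = 0.
  have H (s : R) : 0 <= s * f (u j).
    have : C (s *: u j) 0.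
      exists 0, j.+1, (fun i => if i == j then s else 0).
      rewrite scale0r mul0r add0r; split=> //; split=> //.
      rewrite big_ord_recr /= eqxx big1 ?add0r// => i _.
      by rewrite ltn_eqF// scale0r.
    by move/fC; rewrite functionalZ.
  by apply/le_anti; have := H 1; have := H (-1);
    rewrite mulN1r mul1r oppr_ge0 => -> ->.
have fx : e / 2 <= f x.
  by apply: fC; exists 1, 0, (fun=> 0); rewrite big_ord0 addr0 scale1r mul1r.
(* Then f x <= r |x| + 2 r |x| <= 3 e / 8, against e / 2 <= f x. *)
pose r := e / 8 / (`|x| + 1).
have x1 : 0 < `|x| + 1 by rewrite ltr_wpDl.
have r0 : 0 < r by rewrite !divr_gt0.
have [|j Fj] := FD.2 f r _ r0.
  apply: (@linear_le_continuous _ _ _ 1) => y; rewrite mul1r.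
  exact: linear_norm_le.
have [uj1 Fuj] := Hu j.
have Fu : `|F j (u j)| <= r.
  have := Fj (u j); rewrite fu sub0r normrN => H; apply: le_trans H _.
  by rewrite ler_piMr// ltW.
have Fx : `|F j x| <= 2 * r * `|x|.
  by apply: le_trans (Fuj x) _; rewrite ler_wpM2r// ler_pM2l.
have rx : r * `|x| <= e / 8.
  rewrite /r mulrAC ler_pdivrMr// ler_pM2l ?divr_gt0//; lra.
have := ler_normD (f x - F j x) (F j x); rewrite subrK.
have := Fj x; have := ler_norm (f x); lra.
Qed.

End SeparableDual.

(** * Weak neighbourhoods of 0 and the weakly null derivation *)

Section WeakDerivation.
Context {R : realType} {X : completeNormedModType R}.
Variable F : nat -> {linear X -> R^o}.
Hypothesis FD : dual_dense F.

Definition weak_nbhs0 (m : nat) (y : X) : Prop :=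
  forall j, (j <= m)%N -> `|F j y| <= m.+1%:R^-1.

Lemma weak_nbhs0_mono n m y : (n <= m)%N -> weak_nbhs0 m y -> weak_nbhs0 n y.
Proof.
move=> nm H j jn; apply: le_trans (H j (leq_trans jn nm)) _.
by rewrite lef_pV2 ?posrE// ler_nat.
Qed.

Lemma weakly_null_nbhs0 (y : nat -> X) m : weakly_null y ->
  exists N, forall i, (N <= i)%N -> weak_nbhs0 m (y i).
Proof.
move=> wy; suff H k : exists N, forall i, (N <= i)%N ->
    forall j, (j < k)%N -> `|F j (y i)| <= m.+1%:R^-1.
  by have [N HN] := H m.+1; exists N => i /HN.
elim: k => [|k [N HN]]; first by exists 0.
have /cvgr0Pnorm_lt /(_ m.+1%:R^-1) := wy (F k) (FD.1 k).
rewrite invr_gt0 ltr0n => /(_ isT) [M _ HM].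
exists (maxn N M) => i; rewrite geq_max => /andP[Ni Mi] j.
rewrite ltnS leq_eqVlt => /predU1P[->|jk]; first exact/ltW/HM.
exact: HN.
Qed.

(** Boundedness of the sequence makes the error of approximating f by some [F j] uniform in i. *)
Lemma nbhs0_weakly_null (y : nat -> X) : (forall i, `|y i| <= 1) ->
    (forall m, exists N, forall i, (N <= i)%N -> weak_nbhs0 m (y i)) ->
  weakly_null y.
Proof.
move=> y1 H f fc; apply/cvgr0Pnorm_lt.
suff fy (e : R) : 0 < e -> \forall i \near \oo, `|f (y i)| < e by exact: fy.
move=> e0.
have e20 : 0 < e / 2 by rewrite divr_gt0.
have [j Fj] := FD.2 f _ fc e20.
have [n Hn] := inv_natS_lt e20.
have [N HN] := H (maxn j n).
exists N => // i /= Ni.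
rewrite -[f (y i)](subrK (F j (y i))) (le_lt_trans (ler_normD _ _))//.
rewrite [e]splitr ler_ltD//.
- by apply: le_trans (Fj (y i)) _; rewrite ler_piMr// ltW.
- by apply: le_lt_trans (HN i Ni j (leq_maxl _ _)) (Hn _ (leq_maxr j n)).
Qed.

(** Some [F j] almost norms y. This lets newly picked vectors avoid the earlier ones. *)
Lemma weak_nbhs0_avoid (y : X) : y != 0 -> exists m, ~ weak_nbhs0 m y.
Proof.
move=> y0; have ny : 0 < `|y| by rewrite normr_gt0.
have [|j [_ Fj]] := approx_norming FD y (e := 1 / 2); first by lra.
have ny4 : 0 < `|y| / 4 by rewrite divr_gt0.
have [n Hn] := inv_natS_lt ny4.
exists (maxn j n) => /(_ j (leq_maxl _ _)) H.
by have := le_lt_trans H (Hn _ (leq_maxr j n)); have := ler_norm (F j y); lra.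
Qed.

Lemma weak_nbhs0_avoid_seq (s : seq X) : 0 \notin s ->
  exists m, forall y, y \in s -> ~ weak_nbhs0 m y.
Proof.
elim: s => [|x s IH]; first by exists 0.
rewrite inE negb_or eq_sym => /andP[/weak_nbhs0_avoid[m Hm] /IH[n Hn]].
exists (maxn m n) => y; rewrite inE => /predU1P[->|ys] H.
  by apply: Hm; apply: weak_nbhs0_mono H; apply: leq_maxl.
by apply: (Hn y ys); apply: weak_nbhs0_mono H; apply: leq_maxr.
Qed.

(** The recursion carries the list of vectors already picked and takes the next one in a
    neighbourhood so small that it contains none of them; this gives injectivity. *)
Lemma pick_sequence (Q : nat -> X -> Prop) :
    (forall p y, Q p y -> y != 0) ->
    (forall p m, exists2 y, weak_nbhs0 m y & Q p y) ->
  exists y : nat -> X, [/\ injective y, forall p, weak_nbhs0 p (y p)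
    & forall p, Q p (y p)].
Proof.
move=> Q0 HQ.
have [g Hg] : {g : nat * seq X -> X & forall u, 0 \notin u.2 ->
    [/\ weak_nbhs0 u.1 (g u), Q u.1 (g u) & g u \notin u.2]}.
  apply: (@choice _ _ (fun u y => 0 \notin u.2 ->
    [/\ weak_nbhs0 u.1 y, Q u.1 y & y \notin u.2])) => -[p s] /=.
  have [/weak_nbhs0_avoid_seq[m Hm]|] := boolP (0 \notin s); last by exists 0.
  have [y ym yQ] := HQ p (maxn p m); exists y => _; split=> //.
    by apply: weak_nbhs0_mono ym; apply: leq_maxl.
  apply/negP => /Hm; apply; apply: weak_nbhs0_mono ym; exact: leq_maxr.
pose L := fix L p := if p is q.+1 then g (q, L q) :: L q else [::].
have L0 p : 0 \notin L p.
  elim: p => //= p IH; rewrite inE negb_or IH andbT eq_sym.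
  by have [_ /Q0] := Hg (p, L p) IH.
have Lin p q : (q < p)%N -> g (q, L q) \in L p.
  elim: p => //= p IH; rewrite ltnS leq_eqVlt inE => /predU1P[->|/IH ->].
    by rewrite eqxx.
  by rewrite orbT.
exists (fun p => g (p, L p)); split=> [p q E|p|p]; last 2 first.
- by have [] := Hg (p, L p) (L0 p).
- by have [] := Hg (p, L p) (L0 p).
have [pq|qp|//] := ltngtP p q.
- by have [_ _] := Hg (q, L q) (L0 q); rewrite -E Lin.
- by have [_ _] := Hg (p, L p) (L0 p); rewrite E Lin.
Qed.

Fixpoint wn_derived (S : set (seq X)) (c : cord) : set (seq X) :=
  match c with
  | CZero => S
  | CSucc b => [set s | wn_derived S b s /\
      forall m, exists2 y, weak_nbhs0 m y & wn_derived S b (rcons s y)]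
  | CLim f => \bigcap_n wn_derived S (f n)
  end.

Lemma wn_derived_sub S c : wn_derived S c `<=` S.
Proof.
elim: c => //= [c IH|f IH] s; first by move=> [/IH].
by move=> /(_ 0 I)/IH.
Qed.

Lemma wn_derived_mono S a b : cle a b -> wn_derived S b `<=` wn_derived S a.
Proof.
elim=> {a b} [b|a b _ IH|a f n _ IH|f b _ IH] s //=.
- exact: wn_derived_sub.
- move=> [/IH sa H]; split=> // m.
  by have [y ym /IH] := H m; exists y.
- by move=> /(_ n I)/IH.
- by move=> sb n _; apply: IH.
Qed.

Lemma wn_derived_subset S S' c : S `<=` S' ->
  wn_derived S c `<=` wn_derived S' c.
Proof.
move=> SS; elim: c => //= [c IH|f IH] s.
- move=> [/IH sc H]; split=> // m.
  by have [y ym /IH] := H m; exists y.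
- by move=> H n _; apply/IH/H.
Qed.

Lemma wn_derived_succ S a b s m : wn_derived S a s -> clt b a ->
  exists2 y, weak_nbhs0 m y & wn_derived S b (rcons s y).
Proof. by move=> sa /wn_derived_mono/(_ s sa)[_]; apply. Qed.

(** Survival of [s] itself up to stage b is automatic, by induction on c <= b: extensions surviving
    b also survive c. *)
Lemma wn_derived_succI S b s : S s ->
    (forall m, exists2 y, weak_nbhs0 m y & wn_derived S b (rcons s y)) ->
  wn_derived S (CSucc b) s.
Proof.
move=> Ss H; split=> //; suff Hc c : cle c b -> wn_derived S c s.
  exact: Hc (cle_refl b).
elim: c => [|c IH|f IH] cb //=.
- have cb' := cle_trans (cle_CSucc c) cb; split=> [|m]; first exact: IH.
  by have [y ym yb] := H m; exists y => //; apply: wn_derived_mono cb' _ yb.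
- by move=> n _; apply: IH (cle_trans (cle_lub f n) cb).
Qed.

(** * From weakly null trees to the derivation and back *)

Definition children (T : set (seq X)) (x : seq X) : set (seq X) :=
  [set z | T z /\ exists y, z = rcons x y].

Definition prefix_closed (T : set (seq X)) :=
  ~ T [::] /\ forall x y, x <> [::] -> T (rcons x y) -> T x.

Lemma prefix_closedP T x z : prefix_closed T -> T z -> x <> [::] ->
  prefix x z -> T x.
Proof.
move=> [_ Tc] Tz x0 /prefixP[t zE]; rewrite {}zE in Tz.
elim/last_ind: t Tz => [|t y IH]; first by rewrite cats0.
rewrite -rcons_cat => /Tc H; apply/IH/H.
by case: (x) x0.
Qed.

Lemma strict_prefix (x z : seq X) : prefix x z -> (size x < size z)%N ->
  exists a, prefix (rcons x a) z.
Proof.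
move=> /prefixP[[|a s] ->]; first by rewrite cats0 ltnn.
by exists a; rewrite -cat_rcons prefix_prefix.
Qed.

Lemma prefix_neq_size (x z : seq X) : prefix x z -> x <> z ->
  (size x < size z)%N.
Proof.
move=> /prefixP[[|a s] ->]; first by rewrite cats0.
by move=> _; rewrite size_cat -[X in (X < _)%N]addn0 ltn_add2l.
Qed.

Lemma initial_nodesE T : prefix_closed T -> initial_nodes T = children T [::].
Proof.
move=> Tc; apply/seteqP; split=> z.
- case: z => [[/Tc.1//]|a s [Tz H]]; split=> //; exists a => /=.
  rewrite -(H [:: a])//; last by rewrite /node_le /= eqxx prefix0s.
  by apply: prefix_closedP Tc Tz _ _ => //=; rewrite eqxx prefix0s.
- move=> [Tz [y zy]]; split=> // w Tw; rewrite zy /node_le => /prefixP[t].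
  by case: w Tw => [/Tc.1//|b [|? ?] _ [-> //]].
Qed.

Lemma immediate_successorsE T x : prefix_closed T -> T x ->
  immediate_successors T x = children T x.
Proof.
move=> Tc Tx; apply/seteqP; split=> z.
- move=> [Tz xz nxz H]; split=> //.
  have [a pa] := strict_prefix xz (prefix_neq_size xz nxz); exists a.
  apply/esym/H => //.
  + by apply: prefix_closedP Tc Tz _ pa => //; case: (x).
  + exact: prefix_rcons.
  + by move/(congr1 size)/eqP; rewrite size_rcons ltn_eqF.
- move=> [Tz [y zE]]; split=> //.
  + by rewrite zE; apply: prefix_rcons.
  + by rewrite zE => /(congr1 size)/eqP; rewrite size_rcons ltn_eqF.
  + move=> w Tw xw nxw wz.
    have : (size z <= size w)%N by rewrite zE size_rcons prefix_neq_size.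
    have /prefixP[[|a s] ->] := wz; first by rewrite cats0.
    by rewrite size_cat -[X in (_ <= X)%N]addn0 leq_add2l.
Qed.

(** Initial nodes are treated as children of the empty sequence, although it is not a node, so that
    both kinds of s-subsequences are handled alike. *)
Lemma s_subsequenceE T (y : nat -> X) : prefix_closed T ->
  s_subsequence T y <-> exists2 x, x = [::] \/ T x &
    set_bij setT (children T x) (fun i => rcons x (y i)).
Proof.
move=> Tc; rewrite /s_subsequence initial_nodesE//; split.
- move=> [H|[x [Tx H]]]; first by exists [::] => //; left.
  by exists x; [right|rewrite -immediate_successorsE].
- move=> [x [->|Tx] H]; first by left.
  by right; exists x; rewrite immediate_successorsE.
Qed.

End WeakDerivation.

(** * Injective sequences and enumerations of countable sets *)

Lemma inj_nat_unbounded (g : nat -> nat) N : injective g ->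
  exists n, (N <= g n)%N.
Proof.
move=> gI; apply: contrapT => H.
have : (size (map g (iota 0 N.+1)) <= size (iota 0 N))%N.
  apply: uniq_leq_size; first by rewrite map_inj_uniq// iota_uniq.
  move=> _ /mapP[i _ ->]; rewrite mem_iota add0n leq0n ltnNge.
  by apply/negP => Ni; apply: H; exists i.
by rewrite size_map !size_iota ltnn.
Qed.

Lemma inj_leaves_seq (T : eqType) (y : nat -> T) (L : seq T) : injective y ->
  exists N, forall i, (N <= i)%N -> y i \notin L.
Proof.
move=> yI; elim: L => [|x L [N HN]]; first by exists 0.
have [[k <-]|H] := pselect (exists k, y k = x).
- exists (maxn N k.+1) => i; rewrite geq_max => /andP[/HN Ni ki].
  rewrite inE negb_or Ni andbT; apply/eqP => /yI E.
  by rewrite E ltnn in ki.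
- exists N => i /HN Ni; rewrite inE negb_or Ni andbT; apply/eqP => E.
  by apply: H; exists i.
Qed.

(** Weak nullness is assumed for enumerations of all children of a node, whereas a component of a
    union sees only an infinite family [h] of them. *)
Lemma infinite_countable_enum (T : Type) (C : set T) (h : nat -> T) :
  countable C -> injective h -> (forall n, C (h n)) ->
  exists e : nat -> T, set_bij setT C e.
Proof.
move=> Cc hI hC.
have [g Hg] : {g : T -> nat & forall z, (exists n, h n = z) -> h (g z) = z}.
  apply: (@choice _ _ (fun z n => (exists n, h n = z) -> h n = z)) => z.
  by have [[n <-]|H] := pselect (exists n, h n = z); [exists n|exists 0].
have /card_set_bijP[f [_ fI fS]] : (C #= [set: nat])%card.
  apply: eq_card_nat => //; apply/infiniteP/pcard_surjP.
  exists g => n _; exists (h n) => //.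
  by apply/hI/Hg; exists n.
have [e He] : {e : nat -> T & forall n, C (e n) /\ f (e n) = n}.
  apply: (@choice _ _ (fun n z => C z /\ f z = n)) => n.
  by have [z Cz fz] := fS n I; exists z.
exists e; split=> [n _|m n _ _ E|z Cz]; first by have [] := He n.
- by rewrite -(He m).2 -(He n).2 E.
- exists (f z) => //; have [Ce fe] := He (f z).
  by apply: fI => //; rewrite inE.
Qed.

Lemma is_Ts_countable fs a (A : Type) (le : A -> A -> Prop) : is_Ts fs a le ->
  exists g : A -> nat, injective g.
Proof.
elim=> {a A le} [a _|a b A le _ [g gI] _|a A le _ _ IH].
- by exists id.
- exists (fun u => pickle (u.1, omap g u.2)) =>
    -[m u] [n v] /(pcan_inj (@pickleK _))[->].
  by case: u v => [u|] [v|] //= [/gI ->].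
- have [g gI] : {g : forall n, A n -> nat & forall n, injective (g n)}.
    by exists (fun n => projT1 (cid (IH n))) => n; apply: (projT2 (cid (IH n))).
  exists (fun u => pickle (projT1 u, g _ (projT2 u))).
  move=> [m u] [n v] /(pcan_inj (@pickleK _)) /= [mn]; subst n.
  by move/gI ->.
Qed.

Section TreesAndDerivation.
Context {R : realType} {X : completeNormedModType R}.
Variable F : nat -> {linear X -> R^o}.
Hypothesis FD : dual_dense F.
Variable fs : cord -> nat -> cord.
Hypothesis hfs : fundamental_system fs.
Variable S : set (seq X).
Hypothesis S0 : S [::].

(** In a full enumeration of the children all but finitely many last terms lie in the m-th
    neighbourhood, and an injective family meets those. *)
Lemma wn_child (T : set (seq X)) x (h : nat -> seq X) m :
    countable T -> T `<=` S -> prefix_closed T ->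
    (forall y, s_subsequence T y -> weakly_null y) ->
    x = [::] \/ T x -> injective h -> (forall n, children T x (h n)) ->
  exists n y, weak_nbhs0 F m y /\ h n = rcons x y.
Proof.
move=> Tcount TS Tc Twn Tx hI hT.
have Cc : countable (children T x).
  by apply: sub_countable Tcount; apply: subset_card_le => z [].
have [e [eC eI eS]] := infinite_countable_enum Cc hI hT.
have eE i : rcons x (last 0 (e i)) = e i.
  by have [_ [y ->]] := eC i I; rewrite last_rcons.
have wy : weakly_null (fun i => last 0 (e i)).
  apply/Twn/s_subsequenceE => //; exists x => //.
  by rewrite (_ : (fun _ => _) = e)//; apply/funext => i; rewrite eE.
have [N HN] := weakly_null_nbhs0 FD m wy.
have [k Hk] : {k : nat -> nat & forall n, e (k n) = h n}.
  by apply: (@choice _ _ (fun n k => e k = h n)) => n;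
    have [k _] := eS _ (hT n); exists k.
have kI : injective k by move=> i j E; apply: hI; rewrite -!Hk E.
have [n Nn] := inj_nat_unbounded N kI.
by exists n, (last 0 (e (k n))); split; [exact: HN | rewrite eE].
Qed.

(** Induction on the model, with [h] embedding it above [x]. The image of [h] may miss some
    extensions of [x] in [T], so it is only required to contain the nodes between [x] and each
    [h u]; this passes to grafted copies and to components. *)
Lemma tree_wn_derived (T : set (seq X)) :
    countable T -> T `<=` S -> prefix_closed T ->
    (forall y, s_subsequence T y -> weakly_null y) ->
  forall a (A : Type) (le : A -> A -> Prop), is_Ts fs a le ->
  forall x (h : A -> seq X), x = [::] \/ T x -> (forall u, T (h u)) ->
    injective h -> (forall u v, le u v <-> prefix (h u) (h v)) ->
    (forall u, prefix x (h u) /\ (size x < size (h u))%N) ->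
    (forall u z, T z -> prefix x z -> (size x < size z)%N -> prefix z (h u) ->
      exists v, h v = z) ->
  wn_derived F S a x.
Proof.
move=> Tcount TS Tc Twn.
(* The child of [x] below [h u] lies in [T], hence is some [h v] with v <= u; minimality of u leaves
   [h u] itself. *)
have minimal_child (A : Type) (le : A -> A -> Prop) x (h : A -> seq X) u :
    T (h u) -> (forall u v, le u v <-> prefix (h u) (h v)) ->
    prefix x (h u) /\ (size x < size (h u))%N ->
    (forall u z, T z -> prefix x z -> (size x < size z)%N -> prefix z (h u) ->
      exists v, h v = z) ->
    (forall v, le v u -> v = u) -> children T x (h u).
  move=> Tu hle [px nx] hcl umin; split=> //.
  have [y py] := strict_prefix px nx; exists y.
  have Ty : T (rcons x y) by apply: prefix_closedP Tc Tu _ py; case: (x).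
  have [|v hv] := hcl u _ Ty (prefix_rcons x y) _ py;
    first by rewrite size_rcons.
  by rewrite -hv; congr h; apply/esym/umin/hle; rewrite hv.
move=> a A le; elim=> {a A le}
    [a [a1 a2]|a b A le _ IH [ab ba]|a A le la _ IH] x h Tx hT hI hle hx hcl;
  have Sx : S x by case: (Tx) => [E|/TS//]; rewrite E.
- apply: (wn_derived_mono a1); apply: wn_derived_succI => // m.
  have hch n :
    children T x (h n) by apply: minimal_child (hT n) hle (hx n) hcl _.
  have [n [y [ym hE]]] := wn_child m Tcount TS Tc Twn Tx hI hch.
  by exists y => //=; rewrite -hE; apply: TS.
- have hch n : children T x (h (n, None)).
    apply: minimal_child (hT _) hle (hx _) hcl _ => -[k [u|]] [/= -> //].
  have hb n : wn_derived F S b (h (n, None)).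
    have hn u : prefix (h (n, None)) (h (n, Some u)) by apply/hle.
    have hnlt u : (size (h (n, None)) < size (h (n, Some u)))%N.
      by apply: prefix_neq_size => // /hI.
    apply: (IH _ (fun u => h (n, Some u))) => //.
    - by right.
    - by move=> u v /hI[].
    - by move=> u v; rewrite -hle; split=> [|[]].
    - move=> u z Tz pz nz zu; have [px nx] := hx (n, None).
      have [v hv] := hcl _ z Tz (prefix_trans px pz) (ltn_trans nx nz) zu.
      have /hle[] : prefix (h v) (h (n, Some u)) by rewrite hv.
      case: v hv => [k [v|]] /= hv kn _; first by exists v; rewrite -kn.
      by rewrite -hv kn ltnn in nz.
  apply: (wn_derived_mono ab); apply: wn_derived_succI => // m.
  have hNI : injective (fun n => h (n, None)) by move=> i j /hI[].
  have [n [y [ym hE]]] := wn_child m Tcount TS Tc Twn Tx hNI hch.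
  by exists y => //; rewrite -hE; apply: hb.
- have [_ _ [_ le_sup]] := hfs.1 a la; apply: (wn_derived_mono le_sup) => n _.
  apply: (IH n x (fun u => h (existT A n u))) => //.
  - by move=> u v /hI E; apply: existT_nat_inj E.
  - move=> u v; rewrite -hle; split=> [uv|H]; first exact: union_le_intro.
    by have [w E uw] := union_le_inv H; rewrite (existT_nat_inj E).
  - move=> u z Tz pz nz zu; have [v hv] := hcl _ z Tz pz nz zu.
    have /hle : prefix (h v) (h (existT A n u)) by rewrite hv.
    case: v hv => k v hv H; have ? : k = n by have [y []] := union_le_inv H.
    by subst k; exists v.
Qed.

End TreesAndDerivation.

(** * Building weakly null trees from the derivation *)

Lemma is_Ts_exists fs a : fundamental_system fs -> cle cone a ->
  exists (A : Type) (le : A -> A -> Prop), is_Ts fs a le.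
Proof.
move=> hfs; elim/(well_founded_ind clt_wf): a => a IH a1.
have [a0|[b [ab ba]]|la] := cord_cases a.
- by case: (@clt_irrefl CZero); apply: cle_trans a1 a0.
- have [b1|b0] := cle_or_clt cone b.
    have [A [le Ale]] := IH b ba b1.
    by exists (nat * option A)%type, (graft_le le); apply: Ts_succ Ale _.
  exists nat, eq; apply: Ts_one; split=> //; apply: cle_trans ab _.
  exact/cle_succ/cle_succ_inv.
- have H n : exists P : {A : Type & A -> A ->
    Prop}, is_Ts fs (fs a n) (projT2 P).
    have [A [le Ale]] := IH _ (fs_lt hfs n la) (fs_gt0 hfs n la).
    by exists (existT _ A le).
  have [P HP] := choice H.
  exists {n : nat & projT1 (P n)}, (union_le (fun n => projT2 (P n))).
  exact: Ts_lim.
Qed.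

Section TreeOfDerivation.
Context {R : realType} {X : completeNormedModType R}.
Variable F : nat -> {linear X -> R^o}.
Hypothesis FD : dual_dense F.
Variable fs : cord -> nat -> cord.
Hypothesis hfs : fundamental_system fs.
Variable S : set (seq X).
Hypothesis S0 : forall x y, S (rcons x y) -> y != 0.

(** Weak convergence to 0 along the cofinite filter of [C], independent of any enumeration. *)
Definition almost_null (C : set X) : Prop :=
  forall m, exists L : seq X, forall y, C y -> weak_nbhs0 F m y \/ y \in L.

Lemma almost_null0 C : (forall y, ~ C y) -> almost_null C.
Proof. by move=> C0 m; exists [::] => y /C0. Qed.

Lemma almost_null_sub (C D : set X) : C `<=` D -> almost_null D ->
  almost_null C.
Proof. by move=> CD H m; have [L HL] := H m; exists L => y /CD/HL. Qed.

Lemma almost_null_weakly_null (y : nat -> X) : injective y ->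
  (forall i, `|y i| <= 1) -> almost_null (range y) -> weakly_null y.
Proof.
move=> yI y1 H; apply: (nbhs0_weakly_null FD) => // m.
have [L HL] := H m; have [N HN] := inj_leaves_seq L yI.
by exists N => i /HN Ni; have [//|/(negP Ni)] := HL _ (imageT y i).
Qed.

(** The stages [b p] may vary with p, so that one sequence can serve all components of a tree of
    limit order. *)
Lemma pick_children a (b : nat -> cord) s : (forall p, clt (b p) a) ->
    wn_derived F S a s ->
  exists y : nat -> X, [/\ injective y, almost_null (range y)
    & forall p, wn_derived F S (b p) (rcons s (y p))].
Proof.
move=> ba sa; have [|p m|y [yI yV yb]] :=
    @pick_sequence _ _ _ FD (fun p y => wn_derived F S (b p) (rcons s y)).
- by move=> p y /wn_derived_sub/S0.
- by have [y ym yb] := wn_derived_succ m sa (ba p); exists y.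
exists y; split=> // m; exists (map y (iota 0 m)) => _ [p _ <-].
have [mp|pm] := leqP m p; first by left; apply: weak_nbhs0_mono mp (yV p).
by right; apply: map_f; rewrite mem_iota.
Qed.

(* [h] realizes T(a, s) as a tree of extensions of [s] in [S] whose initial
   nodes are among the [y p]; being almost null is stable under the unions of
   families of immediate successors taken at limit stages, unlike weak
   nullness of a sequence. *)
Definition realizes (A : Type) (le : A -> A -> Prop) (s : seq X) (y : nat -> X)
    (h : A -> seq X) : Prop :=
  [/\ injective h, forall u v, le u v <-> prefix (h u) (h v)
    & forall u, S (s ++ h u)] /\
  [/\ forall u, exists p t, h u = y p :: t,
      forall u z, z <> [::] -> prefix z (h u) -> exists v, h v = z
    & forall t, almost_null [set v | exists u, h u = rcons t v]].

(** [b p] is the stage that the p-th candidate initial node has to survive. It depends on the model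
    alone, so the whole sequence [y] can be picked first, with control across all components, and
    the tree is then built on it. *)
Lemma is_Ts_realizes a (A : Type) (le : A -> A -> Prop) : is_Ts fs a le ->
  exists b : nat -> cord, (forall p, clt (b p) a) /\
    forall s y, injective y -> almost_null (range y) ->
      (forall p, wn_derived F S (b p) (rcons s (y p))) ->
    exists h, realizes le s y h.
Proof.
elim=> {a A le} [a [a1 a2]|a b A le _ [b' [b'b IH]] [ab ba]|a A le la _ IH].
- exists (fun=> CZero); split=> // s y yI yn ys; exists (fun n => [:: y n]).
  split; split.
  + by move=> i j [/yI].
  + move=> i j; split=> [->|]; first exact: prefix_refl.
    by rewrite prefix_cons => /andP[/eqP/yI].
  + by move=> i; rewrite cats1; apply: ys.
  + by move=> i; exists i, [::].
  + move=> i [//|c z] _; rewrite prefix_cons => /andP[/eqP -> ].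
    by rewrite prefixs0 => /eqP ->; exists i.
  + case=> [|c t]; last by apply: almost_null0 => v [u]; case: t.
    by apply: almost_null_sub yn => v [u [<-]]; exists u.
- exists (fun=> b); split=> // s y yI yn ys.
  have {}IH p : exists h, exists z, realizes le (rcons s (y p)) z h.
    have [z [zI zn zs]] := pick_children b'b (ys p).
    by have [h Hh] := IH _ z zI zn zs; exists h, z.
  have [h Hh] := choice IH.
  pose H (u :
    nat * option A) := y u.1 :: (if u.2 is Some v then h u.1 v else [::]).
  have hN p v : h p v <> [::].
    by have [z [_ [Hz _ _]]] := Hh p; have [q [t ->]] := Hz v.
  exists H; split; split.
  + move=> [p [u|]] [q [v|]]; rewrite /H /= => -[/yI <-] //.
    * by have [z [[hI _ _] _]] := Hh p; move=> /hI ->.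
    * by move/hN.
    * by move/esym/hN.
  + move=> [p o] [q o']; rewrite /H prefix_cons /graft_le /=.
    split=> [[<-]|/andP[/eqP/yI <-]].
      rewrite eqxx /=; case: o o' => [u|] [v|] //= uv; last exact: prefix0s.
      by have [z [[_ hle _] _]] := Hh p; apply/hle.
    case: o o' => [u|] [v|] //=.
      by have [z [[_ hle _] _]] := Hh p; move/hle.
    by case E : (h p u) (hN p u) => [].
  + move=> [p [u|]]; rewrite /H /=; last by rewrite cats1;
      apply: wn_derived_sub (ys p).
    by have [z [[_ _ hS] _]] := Hh p; rewrite -cat_rcons.
  + by move=> [p o]; exists p; eexists.
  + move=> [p o] [//|c z] _; rewrite /H prefix_cons /= => /andP[/eqP -> ].
    case: z => [|d z] zo; first by exists (p, None).
    case: o zo => [u|//] /= zo; have [w [_ [_ hcl _]]] := Hh p.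
    by have [||v vE] := hcl u (d :: z) => //; exists (p, Some v); rewrite /= vE.
  + case=> [|c t].
      apply: almost_null_sub yn => v [[p o]]; rewrite /H /= => -[<- _].
      by exists p.
    have [[p <-]|nc] := pselect (exists p, y p = c); last first.
      apply: almost_null0 => v [[p o]]; rewrite /H /= => -[yc _].
      by apply: nc; exists p.
    have [w [_ [_ _ hn]]] := Hh p; apply: almost_null_sub (hn t) => v [[q o]].
    rewrite /H /= => -[/yI ->]; case: o => [u|] E; first by exists u.
    by case: t E.
- have {}IH n : exists b, (forall p, clt (b p) (fs a n)) /\
    forall s y, injective y -> almost_null (range y) ->
      (forall p, wn_derived F S (b p) (rcons s (y p))) ->
    exists h, realizes (le n) s y h := IH n.
  have [b Hb] := choice IH.
  (* One sequence [y] is distributed over the components: [y (code n q)] is the q-th candidate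
     initial node of component n. Indices that are not codes get stage 0. *)
  pose code (n q : nat) : nat := pickle (n, q).
  exists (fun p => if unpickle p is Some u then b u.1 u.2 else CZero).
  split=> [p|s y yI yn ys].
    case: (unpickle p) => [[n q]|] /=; last by case: la.
    exact: cle_trans ((Hb n).1 q) (cltW (fs_lt hfs n la)).
  have codeI n q n' q' : y (code n q) = y (code n' q') -> n = n'.
    by move=> /yI/(pcan_inj (@pickleK _))[].
  have ex_h n : exists h, realizes (le n) s (fun q => y (code n q)) h.
    apply: (Hb n).2.
    - by move=> q q' /yI/(pcan_inj (@pickleK _))[].
    - by apply: almost_null_sub yn => _ [q _ <-]; exists (code n q).
    - by move=> q; have := ys (code n q); rewrite /code pickleK.
  pose h n := projT1 (cid (ex_h n)).
  have Hh n : realizes _ _ _ (h n) := projT2 (cid (ex_h n)).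
  have hh n u : exists q t, h n u = y (code n q) :: t.
    by have [_ [hy _ _]] := Hh n; apply: hy.
  have same n n' u v : prefix (h n u) (h n' v) -> n = n'.
    have [q [t ->]] := hh n u; have [q' [t' ->]] := hh n' v.
    by rewrite prefix_cons => /andP[/eqP/codeI].
  exists (fun u => h _ (projT2 u)); split; split.
  + move=> [n u] [n' v] /= E; have nn : n = n' by apply: (same _ _ u v);
      rewrite E prefix_refl.
    by subst n'; have [[hI _ _] _] := Hh n; rewrite (hI _ _ E).
  + move=> [n u] [n' v] /=; split=> [H|H].
      have [w E uw] := union_le_inv H; have nn : n' = n by case: E.
      subst n'; rewrite (existT_nat_inj E); have [[_ hle _] _] := Hh n.
      exact/hle.
    have nn := same _ _ _ _ H; subst n'; apply: union_le_intro.
    by have [[_ hle _] _] := Hh n; apply/hle.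
  + by move=> [n u] /=; have [[_ _ hS] _] := Hh n.
  + by move=> [n u] /=; have [q [t ->]] := hh n u; exists (code n q), t.
  + move=> [n u] z z0 zu; have [_ [_ hcl _]] := Hh n.
    by have [v vE] := hcl u z z0 zu; exists (existT A n v).
  + case=> [|c t].
      apply: almost_null_sub yn => v [[n u]] /=; have [q [t ->]] := hh n u.
      by move=> [<- _]; exists (code n q).
    have [[n [q qc]]|nc] := pselect (exists n q, y (code n q) = c); last first.
      apply: almost_null0 => v [[n u]] /=; have [q [t' ->]] := hh n u.
      by move=> [yc _]; apply: nc; exists n, q.
    have [_ [_ _ hn]] := Hh n;
      apply: almost_null_sub (hn (c :: t)) => v [[n' u]] /= E.
    have nn : n' = n.
      by move: E; have [q' [t' ->]] := hh n' u => -[]; rewrite -qc => /codeI.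
    by subst n'; exists u.
Qed.

Lemma wn_derived_tree a : (forall x y, S (rcons x y) -> `|y| = 1) ->
    cle cone a -> wn_derived F S a [::] ->
  exists T : set (seq X), [/\ T `<=` S, weakly_null_tree fs T
    & is_tree_order node_le T (Countable_ord a)].
Proof.
move=> S1 a1 Sa; have [A [le Ale]] := is_Ts_exists hfs a1.
have [b [ba HA]] := is_Ts_realizes Ale.
have [y [yI yn ys]] := pick_children ba Sa.
have [h [[hI hle hS] [hy hcl hn]]] := HA [::] y yI yn ys.
have order := is_Ts_order hfs Ale.
have Tc : prefix_closed (range h).
  split=> [[u _ E]|x z x0 [u _ E]]; first by have [p [t]] := hy u; rewrite E.
  have [|v <-] := hcl u x x0; first by rewrite E prefix_rcons.
  by exists v.
exists (range h); split.
- by move=> _ [u _ <-]; apply: hS.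
- split.
  + split; last exact: Tc.1.
    have [u _] := (order CZero).2 a1; by exists (h u), u.
  + exists a; split=> //; split; last exact: Tc.2.
    exists A, le, h; split=> //; split=> [u _|u v _ _ /hI //|_ [u _ <-]];
      by exists u.
  + move=> z /(s_subsequenceE _ Tc)[x _ [zT zI _]].
    have zu i : exists u, h u = rcons x (z i).
      by have [[u _ E] _] := zT i I; exists u.
    apply: almost_null_weakly_null.
    * by move=> i j E; apply: zI; rewrite ?inE// E.
    * move=> i; have [u E] := zu i.
      by rewrite (S1 x)// -E; apply: hS.
    * by apply: almost_null_sub (hn x) => _ [i _ <-]; apply: zu.
- split=> [|c].
  + rewrite (iter_derived_tree_image a hI hle); apply/seteqP;
      split=> // z [u ua _].
    by case: (@clt_irrefl a); apply/order; exists u.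
  + rewrite (iter_derived_tree_image c hI hle) => c0;
      apply/cle_not_clt => /order[u uc].
    by have : (h @` iter_derived_tree le setT c) (h u) by []; rewrite c0.
Qed.

End TreeOfDerivation.

(** * Concatenation of l_1^+ sequences *)

Section Lincomb.
Context {R : realType} {X : completeNormedModType R}.
Implicit Types (s t : seq X) (a b : nat -> R).

Definition lincomb a s : X := \sum_(i < size s) a i *: s`_i.

Definition cat_coef n a b (i : nat) :
  R := if (i < n)%N then a i else b (i - n)%N.

Lemma lincomb_cat a s t :
  lincomb a (s ++ t) = lincomb a s + lincomb (fun i => a (size s + i)%N) t.
Proof.
rewrite /lincomb size_cat big_split_ord /=; congr (_ + _);
  apply: eq_bigr => i _.
- by rewrite nth_cat ltn_ord.
- by rewrite nth_cat ltnNge leq_addr /= addKn.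
Qed.

Lemma lincomb_cat_coef a b s t :
  lincomb (cat_coef (size s) a b) (s ++ t) = lincomb a s + lincomb b t.
Proof.
rewrite lincomb_cat; congr (_ + _); apply: eq_bigr => i _; congr (_ *: _).
- by rewrite /cat_coef ltn_ord.
- by rewrite /cat_coef ltnNge leq_addr /= addKn.
Qed.

Lemma lincomb_take a s n : (n <= size s)%N ->
  lincomb a (take n s) = \sum_(i < n) a i *: s`_i.
Proof.
move=> ns; rewrite /lincomb size_takel//; apply: eq_bigr => i _.
by rewrite nth_take.
Qed.

Lemma lincomb_rcons a s y :
  lincomb a (rcons s y) = lincomb a s + a (size s) *: y.
Proof.
rewrite -cats1 lincomb_cat; congr (_ + _).
by rewrite /lincomb big_ord1 /= addn0.
Qed.

Lemma lincombZ r a s : lincomb (fun i => r * a i) s = r *: lincomb a s.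
Proof.
by rewrite /lincomb scaler_sumr; apply: eq_bigr => i _; rewrite scalerA.
Qed.

Definition partial_sums_le (K : R) s :=
  forall a n, (n <= size s)%N -> `|lincomb a (take n s)| <= K * `|lincomb a s|.

Definition l1plus_lower (K : R) s :=
  forall a, (forall i, 0 <= a i) ->
    K^-1 * \sum_(i < size s) a i <= `|lincomb a s|.

(** Each term is the difference of two consecutive partial sums. *)
Lemma coef_bound K s : normalized s -> partial_sums_le K s ->
  forall a i, (i < size s)%N -> `|a i| <= 2 * K * `|lincomb a s|.
Proof.
move=> sn sK a i ilt.
have := sK a i (ltnW ilt); have := sK a i.+1 ilt.
have -> : `|a i| = `|lincomb a (take i.+1 s) - lincomb a (take i s)|.
  rewrite (take_nth 0)// lincomb_rcons size_takel 1?ltnW//.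
  by rewrite addrAC subrr add0r normrZ sn ?mulr1// mem_nth.
have := ler_normB (lincomb a (take i.+1 s)) (lincomb a (take i s)); lra.
Qed.

(** Linear independence follows from the other conditions through [coef_bound]. *)
Lemma l1plus_sequenceE K s : l1plus_sequence K s <->
  [/\ normalized s, partial_sums_le K s & l1plus_lower K s].
Proof.
split=> [[sn [_ sK] sl]|[sn sK sl]]; split=> //.
- by move=> a n ns; rewrite lincomb_take//; apply: sK.
- split=> [a a0 i ilt|a n ns]; last by rewrite -lincomb_take//; apply: sK.
  have := coef_bound sn sK a ilt; rewrite /lincomb a0 normr0 mulr0.
  by rewrite normr_le0 => /eqP.
Qed.

Lemma l1plus_nil K : l1plus_sequence K ([::] : seq X).
Proof.
apply/l1plus_sequenceE; split=> [u //|a n|a _].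
- by rewrite leqn0 => /eqP ->; rewrite /lincomb !big_ord0 normr0 mulr0.
- by rewrite /lincomb !big_ord0 normr0 mulr0.
Qed.

Lemma l1plus_mono K L s : 0 < K -> K <= L -> l1plus_sequence K s ->
  l1plus_sequence L s.
Proof.
move=> K0 KL /l1plus_sequenceE[sn sK sl]; apply/l1plus_sequenceE; split=> //.
- by move=> a n ns; apply: le_trans (sK a n ns) _; rewrite ler_wpM2r.
- move=> a a0; apply: le_trans (sl a a0); apply: ler_wpM2r.
    by apply: sumr_ge0 => i _.
  by rewrite lef_pV2 ?posrE// (lt_le_trans K0 KL).
Qed.

Lemma l1plus_singleton (y : X) : `|y| = 1 -> l1plus_sequence 1 [:: y].
Proof.
move=> y1; apply/l1plus_sequenceE; split.
- by move=> u; rewrite inE => /eqP ->.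
- move=> a [|[|n]]// _; last by rewrite mul1r.
  by rewrite mul1r /lincomb /= big_ord0 normr0.
- by move=> a a0;
    rewrite /lincomb /= !big_ord1 normrZ y1 mulr1 invr1 mul1r ler_norm.
Qed.

(** Bounds by [c] the norm of the projection onto the span of [s] along that of [t]. *)
Definition projection_le (c : R) s t :=
  forall a b, `|lincomb a s| <= c * `|lincomb a s + lincomb b t|.

(** The projection onto the span of [s] has norm at most 2 and its complement at most 3; each
    contributes a factor K, whence 5 K for both estimates. *)
Lemma l1plus_cat K s t : 1 <= K -> l1plus_sequence K s -> l1plus_sequence K t ->
  projection_le 2 s t -> l1plus_sequence (5 * K) (s ++ t).
Proof.
move=> K1 /l1plus_sequenceE[sn sK sl] /l1plus_sequenceE[tn tK tl] P.
have K0 : 0 < K by lra.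
have split_bound a :
  exists b, [/\ lincomb a (s ++ t) = lincomb a s + lincomb b t,
    `|lincomb a s| <= 2 * `|lincomb a (s ++ t)|,
    `|lincomb b t| <= 3 * `|lincomb a (s ++ t)| &
    b = (fun i => a (size s + i)%N)].
  exists (fun i => a (size s + i)%N).
  have E := lincomb_cat a s t; have Pa := P a (fun i => a (size s + i)%N).
  rewrite -E in Pa; split=> //.
  have := ler_normB (lincomb a (s ++ t)) (lincomb a s).
  by rewrite {1}E addrAC subrr add0r; lra.
apply/l1plus_sequenceE; split.
- by move=> u; rewrite mem_cat => /orP[/sn|/tn].
- move=> a n nst; have [b [E us ut bE]] := split_bound a.
  move: us ut; set N := `|lincomb a (s ++ t)| => us ut.
  have N0 : 0 <= N by rewrite /N.
  have KN : N <= K * N by rewrite ler_peMl.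
  have sK' m : (m <= size s)%N -> `|lincomb a (take m s)| <= 2 * (K * N).
    move=> ms; apply: le_trans (sK a m ms) _; rewrite mulrCA.
    by rewrite ler_pM2l.
  rewrite take_cat; case: ltnP => [ns|sn'].
    by have := sK' n (ltnW ns); lra.
  rewrite lincomb_cat -bE.
  have tK' : `|lincomb b (take (n - size s) t)| <= 3 * (K * N).
    apply: le_trans (tK b _ _) _; first by rewrite leq_subLR -size_cat.
    by rewrite mulrCA ler_pM2l.
  by apply: le_trans (ler_normD _ _) _; lra.
- move=> a a0; have [b [E us ut bE]] := split_bound a.
  have b0 i : 0 <= b i by rewrite bE.
  have := sl a a0; have := tl b b0.
  rewrite size_cat big_split_ord /=.
  rewrite (_ : \sum_(i < size t) a (size s + i)%N = \sum_(i < size t) b i);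
    last by rewrite bE.
  move: (\sum_(i < size s) a i) (\sum_(i < size t) b i) => x y.
  rewrite !ler_pdivrMl//; last by lra.
  move: us ut; set N := `|lincomb a (s ++ t)| => us ut yt xs.
  have : K * `|lincomb a s| <= 2 * (K * N) by rewrite mulrCA ler_pM2l.
  have : K * `|lincomb b t| <= 3 * (K * N) by rewrite mulrCA ler_pM2l.
  lra.
Qed.

(** * Finite nets, Mazur's lemma and sums of stages *)

Lemma scalar_net (M d : R) : 0 < d ->
  exists L : seq R, forall r, `|r| <= M -> exists2 q, q \in L & `|r - q| <= d.
Proof.
move=> d0; suff [L HL] : exists L : seq R, forall r,
    `|r| <= (Num.bound `|M / d|)%:R * d -> exists2 q, q \in L & `|r - q| <= d.
  exists L => r rM; apply: HL; apply: le_trans rM _.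
  rewrite -ler_pdivrMr//; apply: le_trans (ler_norm _) (ltW _).
  exact: archi_boundP.
elim: (Num.bound _) => [|n [L HL]].
  exists [:: 0] => r; rewrite mul0r => r0; exists 0; rewrite ?inE// subr0.
  exact: le_trans r0 (ltW d0).
exists (0 :: map (fun q => q + d) L ++ map (fun q => q - d) L) => r rn.
have [rd|rd] := leP `|r| d.
  by exists 0; rewrite ?inE ?eqxx// subr0.
have nE : n.+1%:R * d = n%:R * d + d by rewrite -natr1 mulrDl mul1r.
rewrite nE in rn.
have [r0|r0] := leP 0 r.
- rewrite ger0_norm// in rn rd.
  have [|q qL Hq] := HL (r - d); first by rewrite ger0_norm; lra.
  exists (q + d); last by rewrite opprD addrA addrAC.
  by rewrite inE mem_cat (map_f (fun q => q + d)) ?orbT.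
- rewrite ltr0_norm// in rn rd.
  have [|q qL Hq] := HL (r + d); first by rewrite ler0_norm; lra.
  exists (q - d); last by rewrite opprB addrA.
  by rewrite inE mem_cat (map_f (fun q => q - d) qL) !orbT.
Qed.

Lemma lincomb_net s (M d : R) : normalized s -> 0 < d ->
  exists L : seq X, forall a, (forall i, (i < size s)%N -> `|a i| <= M) ->
    exists2 z, z \in L & `|lincomb a s - z| <= d.
Proof.
move=> + d0; elim/last_ind: s d d0 => [|s y IH] d d0 sn.
  exists [:: 0] => a _; exists 0; first by rewrite inE.
  by rewrite /lincomb big_ord0 subr0 normr0 ltW.
have d20 : 0 < d / 2 by lra.
have [|L HL] := IH _ d20.
  by move=> u us; apply: sn; rewrite mem_rcons inE us orbT.
have [Q HQ] := scalar_net M d20.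
exists [seq z + q *: y | z <- L, q <- Q] => a aM.
have [|z zL Hz] := HL a.
  by move=> i si; apply: aM; rewrite size_rcons (ltn_trans si).
have [|q qQ Hq] := HQ (a (size s)); first by apply: aM; rewrite size_rcons.
exists (z + q *: y); first by apply/allpairsP; exists (z, q).
rewrite lincomb_rcons opprD addrACA -scalerBl.
have y1 : `|y| = 1 by apply: sn; rewrite mem_rcons mem_head.
by apply: le_trans (ler_normD _ _) _; rewrite normrZ y1; lra.
Qed.

Variable F : nat -> {linear X -> R^o}.
Hypothesis FD : dual_dense F.

Lemma approx_norming_seq (L : seq X) (e : R) : 0 < e ->
  exists m, forall z, z \in L -> exists2 j, (j <= m)%N &
    (forall y, `|F j y| <= (1 + e) * `|y|) /\ (1 - e) * `|z| <= F j z.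
Proof.
move=> e0; elim: L => [|x L [m Hm]]; first by exists 0.
have [j Hj] := approx_norming FD x e0.
exists (maxn j m) => z; rewrite inE => /predU1P[->|/Hm[k km Hk]].
  by exists j => //; apply: leq_maxl.
by exists k => //; apply: leq_trans km (leq_maxr _ _).
Qed.

(* Mazur's lemma. The unit sphere of the span of [s] has a finite net, normed
   by finitely many of the [F j]; these are nearly 0 on [y]. *)
Lemma mazur K s (e : R) : normalized s -> partial_sums_le K s -> 0 < e ->
  exists m, forall y, `|y| = 1 -> weak_nbhs0 F m y -> forall a (r : R),
    `|lincomb a s| <= (1 + e) * `|lincomb a s + r *: y|.
Proof.
(* This choice gives (1 + e) (1 - 6 d) = 1, and the estimates below end with 1 - 6 d <= |w|. *)
move=> sn sK e0; pose d := e / (6 * (1 + e)).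
have e1 : 0 < 6 * (1 + e) by lra.
have d0 : 0 < d by rewrite divr_gt0.
have dE : d * (6 * (1 + e)) = e by rewrite mulfVK// gt_eqF.
have d6 : 6 * d <= 1.
  by rewrite /d mulrA ler_pdivrMr//; lra.
have [L HL] := lincomb_net (2 * K) sn d0.
have [m Hm] := approx_norming_seq L d0.
have [n Hn] := inv_natS_lt d0.
exists (maxn m n) => y y1 yV.
have unit_case a r : `|lincomb a s| = 1 ->
    1 <= (1 + e) * `|lincomb a s + r *: y|.
  (* For |r| > 2 the triangle inequality suffices; otherwise |r F j y| <= 2 d. *)
  move=> u1; have [r2|r2] := ltP 2 `|r|.
    have := ler_normB (lincomb a s + r *: y) (lincomb a s).
    rewrite addrAC subrr add0r normrZ y1 u1 mulr1 => H.
    have N1 : 1 <= `|lincomb a s + r *: y| by lra.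
    by apply: le_trans N1 _; rewrite ler_peMl//; lra.
  have [|z zL uz] := HL a.
    by move=> i si; have := coef_bound sn sK a si; rewrite u1 mulr1.
  have [j jm [Fj Fz]] := Hm z zL.
  have Fy : `|F j y| <= d.
    apply: le_trans (yV j (leq_trans jm (leq_maxl _ _))) (ltW (Hn _ _)).
    exact: leq_maxr.
  have z1 : 1 - d <= `|z|.
    by have := ler_normD (lincomb a s - z) z; rewrite subrK u1; lra.
  set w := lincomb a s + r *: y.
  have wE : F j w = F j z + F j (lincomb a s - z) + r * F j y.
    by rewrite /w linearD functionalZ -[in LHS](subrK z (lincomb a s)) linearD
      [X in X + _]addrC.
  have Fuz : - ((1 + d) * d) <= F j (lincomb a s - z).
    have : `|F j (lincomb a s - z)| <= (1 + d) * d.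
      by apply: le_trans (Fj _) _; rewrite ler_pM2l//; lra.
    by rewrite ler_norml => /andP[].
  have Fry : - (2 * d) <= r * F j y.
    have : `|r * F j y| <= 2 * d by rewrite normrM ler_pM.
    by rewrite ler_norml => /andP[].
  have Fz' : (1 - d) * (1 - d) <= F j z.
    by apply: le_trans Fz; rewrite ler_pM2l//; lra.
  have Fw : F j w <= (1 + d) * `|w| by apply: le_trans (ler_norm _) (Fj w).
  have dw : 1 - 5 * d <= (1 + d) * `|w|.
    by apply: le_trans Fw; rewrite wE; lra.
  have w6 : 1 - 6 * d <= `|w|.
    have d10 : 0 < 1 + d by lra.
    rewrite -(ler_pM2l d10); apply: le_trans dw.
    by have := mulr_ge0 (ltW d0) (ltW d0); lra.
  have e10 : 0 < 1 + e by lra.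
  rewrite -(ler_pM2l e10) in w6; apply: le_trans w6.
  by move: dE; lra.
move=> a r; have [->|u0] := eqVneq (lincomb a s) 0.
  by rewrite normr0; apply: mulr_ge0 => //; lra.
have n0 : 0 < `|lincomb a s| by rewrite normr_gt0.
pose q := `|lincomb a s|^-1.
have q0 : 0 < q by rewrite invr_gt0.
have := unit_case (fun i => q * a i) (q * r).
rewrite lincombZ -scalerA -scalerDr !normrZ (gtr0_norm q0) mulVf ?gt_eqF//.
move=> /(_ erefl); rewrite mulrCA -ler_pdivrMl// invrK mulr1.
by [].
Qed.

(** Induction on the stage, with a projection constant c < 2 for the current [t]. Every extension
    increases c, and the strict inequality leaves room for the next one. *)
Lemma wn_derived_cat K s : 1 <= K -> l1plus_sequence K s ->
  forall x t c, wn_derived F (l1plus_sequence K) x t -> 1 <= c -> c < 2 ->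
    projection_le c s t -> wn_derived F (l1plus_sequence (5 * K)) x (s ++ t).
Proof.
move=> K1 sK.
have catK t c : l1plus_sequence K t -> c < 2 -> projection_le c s t ->
    l1plus_sequence (5 * K) (s ++ t).
  move=> tK c2 P; apply: l1plus_cat => // a b; apply: le_trans (P a b) _.
  by rewrite ler_wpM2r// ltW.
elim=> [|x IH|f IH] t c /= tx c1 c2 P.
- exact: catK tx c2 P.
- have [tx' H] := tx; split=> [|m]; first exact: IH tx' c1 c2 P.
  have tK := wn_derived_sub tx'.
  have /l1plus_sequenceE[stn stK _] := catK t c tK c2 P.
  (* With 2 - c = 4 e, the new constant c (1 + e) is again below 2. *)
  pose e := (2 - c) / 4.
  have e0 : 0 < e by rewrite divr_gt0//; lra.
  have [k Hk] := mazur stn stK e0.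
  have [y yV yx] := H (maxn m k).
  exists y; first exact: weak_nbhs0_mono (leq_maxl _ _) yV.
  have y1 : `|y| = 1.
    have [yn _ _] := wn_derived_sub yx.
    by apply: yn; rewrite mem_rcons mem_head.
  rewrite rcons_cat; apply: (IH _ (c * (1 + e)) yx).
  + by rewrite -[1]mulr1; apply: ler_pM => //; lra.
  + have := mulr_ge0 (_ : 0 <= 2 - c) (_ : 0 <= 2 - c); rewrite /e; nra.
  + move=> a b; rewrite lincomb_rcons addrA -lincomb_cat_coef.
    apply: le_trans (P a b) _; rewrite -mulrA ler_pM2l; last by lra.
    rewrite -lincomb_cat_coef; apply: Hk y1 _ _ _.
    exact: weak_nbhs0_mono (leq_maxr _ _) yV.
- by move=> n _; apply: IH (tx n I) c1 c2 P.
Qed.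

(** Induction on y, for all [s]. At stage 0 the sequence [s] is an arbitrary l_1^+-K-sequence, after
    which everything surviving x stages from the empty sequence can be placed; the y further
    derivations are those of the original set. *)
Lemma wn_derived_cadd K x y : 1 <= K ->
    wn_derived F (l1plus_sequence K) x [::] ->
    wn_derived F (l1plus_sequence K) y [::] ->
  wn_derived F (l1plus_sequence (5 * K)) (cadd x y) [::].
Proof.
move=> K1 x0; suff H z s : wn_derived F (l1plus_sequence K) z s ->
    wn_derived F (l1plus_sequence (5 * K)) (cadd x z) s by apply: H.
elim: z s => [|z IH|f IH] s /=.
- move=> sK; have := wn_derived_cat K1 sK x0 (lexx 1); rewrite cats0; apply.
    by lra.
  by move=> a b; rewrite [lincomb b _]big_ord0 addr0 mul1r.
- move=> [/IH sz H]; split=> // m.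
  by have [v vm /IH] := H m; exists v.
- by move=> H n _; apply/IH/H.
Qed.

End Lincomb.

(** * Lower and upper bounds for the index *)

Section Bounds.
Context {R : realType} {X : completeNormedModType R}.

(** Induction on n: the next functional either vanishes on the common kernel of the previous ones or
    is corrected by one further vector of that kernel. *)
Lemma kernel_finite_codim (F : nat -> {linear X -> R^o}) n :
  exists (k : nat) (e : 'I_k -> X), forall x, exists a : 'I_k -> R,
    forall j, (j < n)%N -> F j (x - \sum_(i < k) a i *: e i) = 0.
Proof.
elim: n => [|n [k [e IH]]].
  by exists 0, (fun=> 0) => x; exists (fun=> 0).
have [[u [u0 Fu]]|H] :=
    pselect (exists u, (forall j, (j < n)%N -> F j u = 0) /\ F n u <> 0);
      last first.
  exists k, e => x; have [a Ha] := IH x; exists a => j.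
  rewrite ltnS leq_eqVlt => /predU1P[->|/Ha//].
  by apply: contrapT => nz; apply: H; eexists; split; first exact: Ha.
exists k.+1, (fun i => if unlift ord0 i is Some j then e j else u) => x.
have [a Ha] := IH x; set w := x - _ in Ha.
exists (fun i => if unlift ord0 i is Some j then a j else F n w / F n u) =>
  j jn.
rewrite big_ord_recl unlift_none.
under eq_bigr => i _ do rewrite liftK.
rewrite opprD addrCA addrC -/w linearB functionalZ.
move: jn; rewrite ltnS leq_eqVlt => /predU1P[->|jn].
  by rewrite mulfVK ?subrr//; apply/eqP.
by rewrite (u0 j jn : F j u = 0 :> R) mulr0 subr0 Ha.
Qed.

(** Infinite dimension gives a nonzero vector on which the first m + 1 functionals vanish. *)
Lemma exists_in_weak_nbhs0 (F : nat -> {linear X -> R^o}) m :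
  infinite_dimensional X -> exists2 y, weak_nbhs0 F m y & `|y| = 1.
Proof.
move=> hdim; have [k [e He]] := kernel_finite_codim F m.+1.
have [z z0 Fz] : exists2 z, z <> 0 & forall j, (j < m.+1)%N -> F j z = 0.
  apply: contrapT => H; apply: hdim; exists k, e => x; have [a Ha] := He x.
  exists a; apply/eqP; rewrite -subr_eq0; apply/eqP; apply: contrapT => nz.
  by apply: H; eexists; [exact: nz | exact: Ha].
have nz : 0 < `|z| by rewrite normr_gt0; apply/eqP.
exists (`|z|^-1 *: z);
  last by rewrite normrZ gtr0_norm ?invr_gt0// mulVf ?gt_eqF.
by move=> j jm; rewrite functionalZ Fz// mulr0 normr0.
Qed.

(* The functional separates 0 from the convex hull of the sequence. *)
Lemma l1plus_functional (x : nat -> X) (r : R) :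
    (forall n (a : nat -> R), (forall i, 0 <= a i) ->
      r * \sum_(i < n) a i <= `|\sum_(i < n) a i *: x i|) ->
  exists f : {linear X ->
    R^o}, (forall y, f y <= `|y|) /\ forall i, r <= f (x i).
Proof.
move=> Hx; pose C y c := exists n (a : nat -> R), (forall i, 0 <= a i) /\
  y = \sum_(i < n) a i *: x i /\ c = r * \sum_(i < n) a i.
pose cut n (a : nat -> R) i := if (i < n)%N then a i else 0.
have cut0 n a : (forall i, 0 <= a i) -> forall i, 0 <= cut n a i.
  by move=> a0 i; rewrite /cut; case: ifP.
have widen (V : lmodType R) (v : nat -> V) n m (a : nat -> R) : (n <= m)%N ->
    \sum_(i < n) a i *: v i = \sum_(i < m) cut n a i *: v i.
  move=> nm; rewrite (big_ord_widen m (fun i => a i *: v i) nm) big_mkcond.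
  by apply: eq_bigr => i _; rewrite /cut; case: ifP => // _; rewrite scale0r.
have widen1 n m (a : nat -> R) : (n <= m)%N ->
    \sum_(i < n) a i = \sum_(i < m) cut n a i.
  move=> nm; have := widen R^o (fun=> 1) n m a nm.
  by under eq_bigr do rewrite [_ *: _]mulr1;
    under [RHS]eq_bigr do rewrite [_ *: _]mulr1.
have CC : convex_cone C.
  split=> [|y c z d [n [a [a0 [-> ->]]]] [m [b [b0 [-> ->]]]]|s y c s0 [n [a
    [a0 [-> ->]]]]].
  - by exists 0, (fun=> 0); rewrite !big_ord0 mulr0.
  - exists (maxn n m), (fun i => cut n a i + cut m b i).
    split; first by move=> i; apply: addr_ge0; apply: cut0.
    have nm := leq_maxl n m; have mn := leq_maxr n m.
    rewrite (widen X x n _ a nm) (widen X x m _ b mn).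
    rewrite (widen1 n _ a nm) (widen1 m _ b mn) -mulrDr -!big_split /=.
    by split=> //; apply: eq_bigr => i _; rewrite scalerDl.
  - exists n, (fun i => s * a i); split; first by move=> i; apply: mulr_ge0.
    rewrite mulrCA mulr_sumr scaler_sumr; split=> //.
    by apply: eq_bigr => i _; rewrite scalerA.
have [f [fn fC]] : exists f : {linear X -> R^o},
    (forall x, f x <= `|x|) /\ forall y c, C y c -> c <= f y.
  apply: hahn_banach_cone norm_sublinear CC _ => y c [n [a [a0 [-> ->]]]].
  exact: Hx.
exists f; split=> // i; apply: fC.
exists i.+1, (fun j => if j == i then 1 else 0).
split; first by move=> j; case: ifP.
rewrite !big_ord_recr /= eqxx !big1 ?add0r ?scale1r ?mulr1// => j _;
  by rewrite ltn_eqF ?scale0r.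
Qed.

Section Countable.
Variable F : nat -> {linear X -> R^o}.
Hypothesis FD : dual_dense F.

(* An infinite branch of approximants would be a weakly null sequence that is
   bounded away from 0 on convex combinations, contradicting Mazur. *)
Lemma no_weakly_null_l1plus (K : R) (x : nat -> X) : 1 <= K ->
    (forall k, exists s, [/\ size s = k, l1plus_sequence K s &
      forall i, (i < k)%N -> weak_nbhs0 F i s`_i /\
        `|s`_i - x i| <= (4 * K)^-1 * i.+1%:R^-1]) ->
  False.
Proof.
move=> K1 H; have K0 : 0 < K by lra.
have inv1 i : (i.+1%:R^-1 : R) <= 1 by rewrite invf_le1// ler1n.
have inv0 i : 0 <= (i.+1%:R^-1 : R) by rewrite invr_ge0.
have K40 : 0 < (4 * K)^-1 by rewrite invr_gt0; lra.
(* Half of 1/K: replacing the terms of [s] by the [x i] costs at most r times the coefficient sum,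
   out of a lower bound 2 r. *)
pose r := (2 * K)^-1.
have r0 : 0 < r by rewrite invr_gt0; lra.
have KE : K^-1 = 2 * r by rewrite /r invfM mulrA mulfV ?mul1r.
have K4E : (4 * K)^-1 = r / 2.
  by rewrite (_ : 4 * K = 2 * K * 2); [rewrite invfM|lra].
have r1 : r <= 1 by rewrite invf_le1; lra.
have [|f [fn fx]] := @l1plus_functional x r.
  move=> n a a0; have [s [sn sK sx]] := H n.
  have /l1plus_sequenceE[_ _ /(_ a a0)] := sK.
  rewrite /lincomb sn KE => lower.
  have diff : `|\sum_(i < n) a i *: s`_i - \sum_(i < n) a i *: x i| <=
      r * \sum_(i < n) a i.
    rewrite -sumrB mulr_sumr;
      apply: le_trans (ler_norm_sum _ _ _) (ler_sum _ _).
    move=> i _; rewrite -scalerBr normrZ ger0_norm// mulrC ler_wpM2r//.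
    have [_ six] := sx i (ltn_ord i); apply: le_trans six _.
    rewrite K4E; apply: le_trans (ler_wpM2l _ (inv1 i)) _; lra.
  have := ler_normD (\sum_(i < n) a i *: s`_i - \sum_(i < n) a i *: x i)
    (\sum_(i < n) a i *: x i); rewrite subrK.
  by move: lower diff; lra.
have r40 : 0 < r / 4 by lra.
have [|j Fj] := FD.2 f (r / 4) _ r40.
  apply: (@linear_le_continuous _ _ _ 1) => y; rewrite mul1r.
  exact: linear_norm_le.
have [M M0 HM] := continuous_linear_le (FD.1 j).
(* With q = 1/(i + 1) below this number, |F j (x i)| <= (1 + M) q < r/4 and |f (x i) - F j (x i)| <=
   r/2, against r <= f (x i). *)
have q0 : 0 < r / 4 / (1 + M) by apply: divr_gt0 => //; lra.
have [n Hn] := inv_natS_lt q0.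
pose i := maxn j n; have [s [_ sK sx]] := H i.+1.
have [siV six] := sx i (ltnSn i).
have Fs := siV j (leq_maxl _ _).
have := Hn i (leq_maxr _ _); move: Fs six (inv0 i) (inv1 i).
move: (i.+1%:R^-1) => q Fs six q00 q1 qlt.
rewrite ltr_pdivlMr in qlt; last by lra.
have sx1 : `|s`_i - x i| <= q.
  apply: le_trans six _; rewrite K4E ler_piMl//; lra.
have s1 : `|s`_i| <= 1.
  have [isz|] := ltnP i (size s); last by move=> ?; rewrite nth_default ?normr0.
  by have [sn _ _] := sK; rewrite sn// mem_nth.
have x2 : `|x i| <= 2.
  by have := ler_normB (s`_i) (s`_i - x i); rewrite opprB addrC subrK; lra.
have Fsx : `|F j (s`_i - x i)| <= M * q.
  by apply: le_trans (HM _) _; rewrite ler_pM2l.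
have fFx : `|f (x i) - F j (x i)| <= r / 4 * 2.
  by apply: le_trans (Fj _) _; rewrite ler_pM2l.
have := fx i; have E : F j (s`_i) - F j (s`_i - x i) = F j (x i).
  by rewrite linearB opprB addrC subrK.
move: Fs Fsx fFx; rewrite !ler_norml -E.
move: (F j (s`_i)) (F j (s`_i - x i)) (f (x i)) => A B D.
move=> /andP[? ?] /andP[? ?] /andP[? ?] ?; lra.
Qed.

(** Replacing vectors by indices into a dense sequence leaves only countably many one-term
    extensions, whose failing stages have a countable supremum. *)
Lemma wn_derived_bounded (K : R) : 1 <= K ->
  exists c, ~ wn_derived F (l1plus_sequence K) c [::].
Proof.
move=> K1; apply: contrapT => noc.
have [d Hd] := separable_of_dual_dense FD.
pose e i : R := (4 * K)^-1 * i.+1%:R^-1.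
have e0 i : 0 < e i by rewrite mulr_gt0// invr_gt0//; lra.
pose approx (u : seq nat) (s : seq X) :=
  [/\ size s = size u, l1plus_sequence K s & forall i, (i < size u)%N ->
    weak_nbhs0 F i s`_i /\ `|s`_i - d (nth 0%N u i)| <= e i].
(* The surviving [s] may depend on c; only its index sequence [u] is fixed. *)
pose bad u := forall c, exists2 s, approx u s &
  wn_derived F (l1plus_sequence K) c s.
have bad0 : bad [::].
  move=> c; exists [::]; first by split=> //; apply: l1plus_nil.
  by apply: contrapT => nc; apply: noc; exists c.
have bad_rcons u : exists n, bad u -> bad (rcons u n).
  have [bu|] := pselect (bad u); last by exists 0.
  have [[n bn]|H] := pselect (exists n, bad (rcons u n)); first by exists n.
  have {}H n : exists c, forall s, approx (rcons u n) s ->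
      ~ wn_derived F (l1plus_sequence K) c s.
    have /existsNP[c Hc] : ~ bad (rcons u n) by move=> bn; apply: H; exists n.
    by exists c => s us sc; apply: Hc; exists s.
  have [c Hc] := choice H.
  (* If extension by each n fails at stage [c n], one stage beyond the supremum yields an extension
     surviving all [c n], and its last term is close to some [d n]. *)
  have [s [su sK sV] [_ sc]] := bu (CSucc (CLim c)).
  have [y yV yc] := sc (size u).
  have [n yn] := Hd y _ (e0 (size u)).
  case: (Hc n (rcons s y)); last exact: (yc n I).
  split; first by rewrite !size_rcons su.
    exact: (@wn_derived_sub _ _ F _ (CLim c)) yc.
  move=> i; rewrite size_rcons ltnS leq_eqVlt !nth_rcons su => /predU1P[->|iu].
    by rewrite ltnn eqxx; split=> //; apply: ltW.
  by rewrite iu; apply: sV.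
have [g Hg] := choice bad_rcons.
pose u := fix u k := if k is l.+1 then rcons (u l) (g (u l)) else [::].
have ubad k : bad (u k) by elim: k => //= k IH; apply: Hg.
have uE k : u k = mkseq (fun i => g (u i)) k.
  by elim: k => //= k IH; rewrite mkseqS {1}IH.
apply: (@no_weakly_null_l1plus K (fun i => d (g (u i))) K1) => k.
have [s [su sK sV] _] := ubad k CZero.
rewrite uE size_mkseq in su sV.
by exists s; split=> // i ik; have := sV i ik; rewrite nth_mkseq.
Qed.

End Countable.

End Bounds.

(** * Orders of l_1^+-weakly null trees and their supremum *)

Lemma l1plus_tree_order (fs : cord -> nat -> cord) (R : realType)
    (X : completeNormedModType R) (F : nat -> {linear X -> R^o}) (K : R)
    (T : set (seq X)) w :
    fundamental_system fs -> dual_dense F ->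
    l1plus_weakly_null_tree fs K T -> is_tree_order node_le T w ->
  exists2 a, w = Countable_ord a & wn_derived F (l1plus_sequence K) a [::].
Proof.
move=> hfs FD [[[_ T0] [a [_ [[A [le [h [Ale hT hle]]]] Tc]]] Twn] TK] Tw.
have TE : T = range h.
  have [hf _ hs] := hT; apply/seteqP; split=> z.
    by move=> /hs[u _ <-]; exists u.
  by move=> [u _ <-]; apply: hf.
have hI : injective h by have [_ hI _] := hT => u v E; apply: hI; rewrite ?inE.
have order := is_Ts_order hfs Ale.
have Ta : iter_derived_tree node_le T a = set0.
  rewrite TE (iter_derived_tree_image a hI hle); apply/seteqP;
    split=> // z [u ua _].
  by case: (@clt_irrefl a); apply/order; exists u.
have Tcount : countable T.
  have [g gI] := is_Ts_countable Ale; rewrite TE.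
  have hs z : exists n, range h z -> exists2 u, h u = z & g u = n.
    have [[u _ <-]|H] := pselect (range h z); first by exists (g u) => _;
      exists u.
    by exists 0%N.
  have [k Hk] := choice hs; apply/countable_injP; exists k => y z.
  rewrite !inE => /Hk[u <- <-] /Hk[v <- <-] E; congr h; exact: gI.
have Sa : wn_derived F (l1plus_sequence K) a [::].
  apply: (tree_wn_derived FD hfs (l1plus_nil K) Tcount _ _ Twn Ale (h := h)) =>
    //.
  - by left.
  - by move=> u; rewrite TE; exists u.
  - move=> u; split; first exact: prefix0s.
    have : T (h u) by rewrite TE; exists u.
    by case: (h u) => // /T0.
  - by move=> u z; rewrite TE => -[v _ <-] *; exists v.
(* The a-th derived tree is empty, so the order is a countable b <= a, and the empty sequence,
   surviving a stages, survives b. *)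
case: w Tw => [b [_ Hb]|H]; last by case: (H a).
exists b => //; exact: wn_derived_mono (Hb _ Ta) _ Sa.
Qed.

Theorem theorem3p22 (fs : cord -> nat -> cord) (hfs : fundamental_system fs)
    (R : realType) (X : completeNormedModType R)
    (hdim : infinite_dimensional X) (hsep : separable_dual X) :
  exists a : cord, is_l1plus_wn_index fs X (Countable_ord (omega_pow a)).
Proof.
have [F FD] := separable_dual_dense hsep.
pose Ix x := exists2 K : R, 1 <= K & wn_derived F (l1plus_sequence K) x [::].
have derived_mono (K L : R) x : 1 <= K -> K <= L ->
    wn_derived F (l1plus_sequence K) x [::] ->
      wn_derived F (l1plus_sequence L) x [::].
  move=> K1 KL; apply: wn_derived_subset => s; apply: l1plus_mono KL.
  exact: lt_le_trans ltr01 K1.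
have Ix1 : Ix cone.
  exists 1 => //; apply: wn_derived_succI => [|m]; first exact: l1plus_nil.
  have [y ym y1] := exists_in_weak_nbhs0 F m hdim; exists y => //.
  exact: l1plus_singleton.
have Ixdown x y : cle x y -> Ix y -> Ix x.
  by move=> xy [K K1 Ky]; exists K => //; apply: wn_derived_mono xy _ Ky.
have Ixadd x y : Ix x -> Ix y -> Ix (cadd x y).
  move=> [K K1 Kx] [L L1 Ly]; exists (5 * Num.max K L).
    have : 1 <= Num.max K L by rewrite le_max K1.
    lra.
  apply: wn_derived_cadd => //; first by rewrite le_max K1.
  - by apply: derived_mono Kx => //; rewrite le_max lexx.
  - by apply: derived_mono Ly => //; rewrite le_max lexx orbT.
(* A failing stage for each integer constant: integers are cofinal among the K, so the supremum of
   these stages bounds [Ix]. *)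
have unbounded (n : nat) :
    exists c, ~ wn_derived F (l1plus_sequence (n.+1%:R : R)) c [::].
  by apply: (wn_derived_bounded FD); rewrite ler1n.
have [c Hc] := choice unbounded.
have Ixb x : Ix x -> cle x (omega_pow (CLim c)).
  move=> [K K1 Kx]; apply: cle_trans (cle_omega_pow _).
  pose n := Num.bound K; apply: (@cle_lim _ _ n); apply/cle_not_clt => cx.
  apply: (Hc n); apply: wn_derived_mono (cltW cx) _ _.
  apply: derived_mono Kx => //; apply: ltW.
  apply: lt_trans (archi_boundP (le_trans ler01 K1)) _.
  by rewrite ltr_nat.
have [a [Ha aH]] := additively_closed_lub Ix1 Ixdown Ixadd Ixb.
have tree_order K w : 1 <= K ->
    [set w | exists T : set (seq X),
      l1plus_weakly_null_tree fs K T /\ is_tree_order node_le T w] w ->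
    exists2 b, w = Countable_ord b & Ix b.
  move=> K1 [T [TK Tw]]; have [b -> Kb] := l1plus_tree_order hfs FD TK Tw.
  by exists b => //; exists K.
exists a; split=> [u [K [K1 [_ Ku]]]|w Hw].
  by apply: Ku => v /(tree_order _ _ K1)[b -> /Ha].
case: w Hw => [w|] Hw; last by [].
apply: aH => x [K K1 Kx].
(* Trees are built only for orders at least 1; otherwise x denotes 0 and lies below [w]. *)
have [x1|x0] := cle_or_clt cone x; last first.
  by apply: cle_trans (cle_zero w); apply: cle_succ_inv.
have [T [TK Twn Tx]] : exists T : set (seq X), [/\ T `<=` l1plus_sequence K,
    weakly_null_tree fs T & is_tree_order node_le T (Countable_ord x)].
  apply: (wn_derived_tree FD hfs _ _ x1 Kx) => s y [yn _ _].
    by rewrite -normr_eq0 yn ?oner_eq0// mem_rcons mem_head.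
  by apply: yn; rewrite mem_rcons mem_head.
(* [w] is known to bound only the suprema taken for each K, so the supremum [v] for this K is
   produced first; it exists because these orders are at most omega^a. *)
pose Tord b := exists T : set (seq X),
  l1plus_weakly_null_tree fs K T /\ is_tree_order node_le T (Countable_ord b).
have [v [Hv vH]] : exists v, (forall b, Tord b -> cle b v) /\
    forall w, (forall b, Tord b -> cle b w) -> cle v w.
  apply: (@bounded_cord_has_lub _ (omega_pow a)) =>
    b /(tree_order _ _ K1)[_ [<-]].
  exact: Ha.
apply: cle_trans (Hv x _) _; first by exists T.
apply: (Hw (Countable_ord v)); exists K; split=> //; split=> [u Hu|[u|]//= Hu].
- by have [b uE _] := tree_order _ _ K1 Hu; rewrite uE in Hu *; apply: Hv.
- by apply: vH => b; apply: (Hu (Countable_ord b)).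
Qed.
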